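(* Let $p,s,n$ be integers with $0<p<n$ and $0<s<n$. Then the canonical blow-up $\mathcal T_{s,p,n}$ of the Grassmannian $G(p,n)$ with respect to the parameter $s$ is smooth.
   Context: Everything is over $\mathbb C$. $G(p,n)$ is the Grassmannian of $p$-planes in $\mathbb C^n$; a point $x$ is represented by a $p\times n$ matrix $\widetilde x$ of rank $p$, modulo left multiplication by $GL(p,\mathbb C)$. Let $\mathbb I_{p,n}=\{(i_1,\dots,i_p)\in\mathbb Z^p: 1\le i_p<\dots<i_1\le n\}$; for $I\in\mathbb I_{p,n}$ let $P_I(\widetilde x)$ be the determinant of the submatrix of $\widetilde x$ formed by columns $i_1,\dots,i_p$. The Plücker embedding is $e:G(p,n)\to\mathbb{CP}^{N_{p,n}}$, $x\mapsto[P_I(\widetilde x)]_{I\in\mathbb I_{p,n}}$. For $0\le k\le p$ let $\mathbb I^k_{s,p,n}\subset\mathbb I_{p,n}$ be the set of indices having exactly $k$ entries in $\{s+1,\dots,n\}$ and $p-k$ entries in $\{1,\dots,s\}$, and let $N^k_{s,p,n}=|\mathbb I^k_{s,p,n}|-1$. Let $\mathcal K_{s,p,n}:G(p,n)\dashrightarrow\mathbb{CP}^{N_{p,n}}\times\mathbb{CP}^{N^0_{s,p,n}}\times\cdots\times\mathbb{CP}^{N^p_{s,p,n}}$ be the rational map $x\mapsto\big([P_I(\widetilde x)]_{I\in\mathbb I_{p,n}},[P_I(\widetilde x)]_{I\in\mathbb I^0_{s,p,n}},\dots,[P_I(\widetilde x)]_{I\in\mathbb I^p_{s,p,n}}\big)$,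 with the convention that $\mathbb{CP}^{N^k_{s,p,n}}$ is a point (and the corresponding component map is trivial) when $N^k_{s,p,n}\in\{0,-1\}$. $\mathcal T_{s,p,n}$ is the scheme-theoretic closure of the birational image of $G(p,n)$ under $\mathcal K_{s,p,n}$. *)

(* Defs.v *)
From HB Require Import structures.
From mathcomp Require Import all_boot all_order all_algebra.
From mathcomp Require Import mpoly complex.
From mathcomp Require Import reals.

Set Implicit Arguments.
Unset Strict Implicit.
Unset Printing Implicit Defensive.

Import GRing.Theory.
Local Open Scope ring_scope.

(** * Smoothness of a closed subscheme of affine space *)

Section Affine.

Variables (K : fieldType) (m : nat).
Implicit Types (I : {mpoly K[m]} -> Prop) (z : 'I_m -> K).

Definition zero_locus I z : Prop := forall f, I f -> f.@[z] = 0.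

(** Smoothness over [K] at the rational point [z] of the closed subscheme of
    [A^m] with ideal [I], as in Bosch-Luetkebohmert-Raynaud, Neron Models,
    Definition 2.2/3: the ideal is generated locally at [z] by finitely many
    elements [g] whose differentials at [z] are linearly independent.  The
    second clause says that [I] is generated by [g] in the local ring of [A^m]
    at [z]: a denominator is a polynomial [h] with [h(z) != 0]. *)
Definition smooth_at I z : Prop :=
  exists (c : nat) (g : 'I_c -> {mpoly K[m]}),
    [/\ forall i, I (g i),
        forall f, I f ->
          exists (h : {mpoly K[m]}) (a : 'I_c -> {mpoly K[m]}),
            h.@[z] != 0 /\ h * f = \sum_(i < c) a i * g i
      & row_free (\matrix_(i < c, j < m) ((g i)^`M(j)).@[z])].

End Affine.

(** * The rational map and the closure of its image *)

Section Blowup.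

Variables (K : fieldType) (s p n : nat).

(** Strictly decreasing sequences; columns are numbered from 0, so the range
    {s+1, ..., n} of the usual 1-based numbering is [s <= i < n] here. *)
Definition plucker_index : Type :=
  {I : {ffun 'I_p -> 'I_n} |
     [forall a : 'I_p, forall b : 'I_p, (a < b)%N ==> (I b < I a)%N]}.

HB.instance Definition _ := Finite.on plucker_index.

Definition plucker (I : plucker_index) (x : 'M[K]_(p, n)) : K :=
  \det (colsub (val I) x).

(** [None] stands for the projective space with all the Pluecker coordinates,
    [Some k] for the one with the coordinates having exactly [k] entries among
    the last [n - s] columns. *)
Definition block (c : option 'I_p.+1) : {set plucker_index} :=
  if c is Some k then
    [set I : plucker_index | #|[set a : 'I_p | (s <= val I a)%N]| == k]
  else setT.

(** Projective spaces on at most one coordinate are points, with trivial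
    component map: these factors of the product are left out.
    ([None] always remains when [0 < p < n].) *)
Definition factor : Type := {c : option 'I_p.+1 | (1 < #|block c|)%N}.

HB.instance Definition _ := Finite.on factor.

(** A standard affine chart of the product: one homogeneous coordinate, to be
    set to 1, in each factor. *)
Definition chart : Type :=
  {J : {ffun factor -> plucker_index} | [forall c, J c \in block (val c)]}.

Definition chart_coord (J : chart) : Type :=
  {cI : factor * plucker_index |
     (cI.2 \in block (val cI.1)) && (cI.2 != val J cI.1)}.

HB.instance Definition _ (J : chart) := Finite.on (chart_coord J).

Definition chart_dim (J : chart) : nat := #|{: chart_coord J}|.

(** [x] represents a point of the Grassmannian at which the rational map is
    defined and takes its value in the chart [J]. *)
Definition in_chart (J : chart) (x : 'M[K]_(p, n)) : Prop :=
  row_free x /\ forall c : factor, plucker (val J c) x != 0.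

(** The value of the rational map in the coordinates of the chart [J]; it is
    unchanged when [x] is multiplied on the left by an invertible matrix. *)
Definition chart_map (J : chart) (x : 'M[K]_(p, n)) : 'I_(chart_dim J) -> K :=
  fun i => let cI := val (enum_val i : chart_coord J) in
           plucker cI.2 x / plucker (val J cI.1) x.

(** The ideal, in the chart [J], of the scheme-theoretic closure of the image:
    the kernel of the pullback of functions to the Grassmannian.  As the
    Grassmannian is reduced and [K] is meant to be algebraically closed, the
    pullback is zero when it vanishes at all [K]-points. *)
Definition blowup_ideal (J : chart) (f : {mpoly K[chart_dim J]}) : Prop :=
  forall x : 'M[K]_(p, n), in_chart J x -> f.@[@chart_map J x] = 0.

(** The charts cover the product, and over an algebraically closed field it is
    enough to consider closed points, the smooth locus being open. *)
Definition blowup_smooth : Prop :=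
  forall (J : chart) (z : 'I_(chart_dim J) -> K),
    zero_locus (@blowup_ideal J) z -> smooth_at (@blowup_ideal J) z.

End Blowup.

(* Main.v *)
From HB Require Import structures.
From mathcomp Require Import all_boot all_order all_algebra all_fingroup.
From mathcomp Require Import mpoly reals complex ring zify.
Require Import Defs.

(** Around a point with a nonzero Pluecker coordinate [f0], a plane is the row space
    of a matrix whose columns [f0] form the identity.  Split rows and columns
    according to the position of the columns of the identity and of the other
    columns with respect to [s].  The two diagonal blocks of the remaining entries
    are free, and an off-diagonal block is written L D U with
    D = diag(t_0, t_0 t_1, t_0 t_1 t_2, ...).  Then all Pluecker coordinates that
    have [l] more entries on one side of [s] than [f0] are divisible, as polynomials
    in the entries of L and U and in the [t_i], by the leading minor of order [l] of
    the block.  Hence the closure of the image, in the chart where these leading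
    minors are the homogeneous coordinates set to 1, is parametrized by an affine
    space; since the parameters are themselves coordinates of the chart, it is the
    graph of a polynomial map, and therefore smooth.

    Every point of the closure lies in such a chart up to the choice of the pivots:
    they are found one at a time, because the quadratic exchange relations between
    the Pluecker coordinates with [k] and with [k + 1] entries beyond [s] persist on
    the closure.  Smoothness is then carried to the given chart by the birational
    change of coordinates between two charts. *)

Set Implicit Arguments.
Unset Strict Implicit.
Unset Printing Implicit Defensive.

Import GRing.Theory Num.Theory.
Local Open Scope ring_scope.

(** * Polynomials and graphs of polynomial maps *)

(** Constants and variables generate the ring, so identities between ring morphisms or derivations
    reduce to these four cases. *)
Lemma mpoly_ring_ind (R : comNzRingType) n (P : {mpoly R[n]} -> Prop) :
    (forall c, P c%:MP) -> (forall i, P 'X_i) ->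
    (forall f g, P f -> P g -> P (f + g)) ->
    (forall f g, P f -> P g -> P (f * g)) ->
  forall f, P f.
Proof.
move=> PC PX PD PM; elim/mpolyind => [|c m f _ _ Pf]; first exact: (PC 0).
apply: (PD) => //; rewrite -mul_mpolyC; apply: (PM) => //.
rewrite mpolyXE_id.
apply: big_ind => [||i _]; [by rewrite -mpolyC1 | exact: (PM) |].
by elim: (m i) => [|k IH]; rewrite ?expr0 -?mpolyC1 // exprS; apply: (PM).
Qed.

Lemma poly_eq0_horner (K : numDomainType) (f : {poly K}) :
  (forall x, f.[x] = 0) -> f = 0.
Proof.
move=> f0; apply/eqP/negPn/negP => fn0.
pose s := [seq k%:R : K | k <- iota 0 (size f)].
have: (size s < size f)%N.
  apply: max_poly_roots => //; first by apply/allP => x _; rewrite /root f0.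
  by rewrite map_inj_uniq ?iota_uniq // => i j /eqP; rewrite eqr_nat => /eqP.
by rewrite size_map size_iota ltnn.
Qed.

Lemma mcoeff0_meval (R : comNzRingType) n (f : {mpoly R[n]}) :
  f@_0 = f.@[fun=> 0].
Proof.
elim/mpoly_ring_ind: f => [c|i|f g Ef Eg|f g Ef Eg].
- by rewrite mcoeffC eqxx mulr1 mevalC.
- rewrite mevalXU mcoeffX; case: eqP => // /mnmP/(_ i).
  by rewrite mnm1E mnm0E eqxx.
- by rewrite mcoeffD mevalD Ef Eg.
- by rewrite mevalM -Ef -Eg; exact: rmorphM.
Qed.

(* Stated for all points at once so that it can be iterated: in characteristic 0
   the Taylor coefficients of a function that vanishes everywhere are zero. *)
Lemma mderiv_eq0_meval (K : numDomainType) n (f : {mpoly K[n]}) i :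
  (forall z, f.@[z] = 0) -> forall z, f^`M(i).@[z] = 0.
Proof.
move=> f0 z.
(* Restriction to the line through [z] along the [i]-th axis: it vanishes everywhere, and its
   derivative at 0 is the partial derivative. *)
pose l j : {poly K} := (z j)%:P + (j == i)%:R *: 'X.
have lE (g : {mpoly K[n]}) x :
    (mmap polyC l g).[x] = g.@[fun j => z j + (j == i)%:R * x].
  elim/mpoly_ring_ind: g => [c|j|g h Eg Eh|g h Eg Eh].
  - by rewrite mmapC hornerC mevalC.
  - by rewrite mmapX mmap1U mevalXU /l !hornerE.
  - by rewrite mmapD hornerD mevalD Eg Eh.
  - by rewrite rmorphM hornerM mevalM Eg Eh.
have lD (g : {mpoly K[n]}) :
    (mmap polyC l g)^`().[0] = g^`M(i).@[z].
  have l0 (h : {mpoly K[n]}) : (mmap polyC l h).[0] = h.@[z].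
    by rewrite lE; apply: meval_eq => j; rewrite mulr0 addr0.
  elim/mpoly_ring_ind: g => [c|j|g h Eg Eh|g h Eg Eh].
  - by rewrite mmapC derivC horner0 mderivC meval0.
  - rewrite mmapX mmap1U derivD derivC derivZ derivX add0r !hornerE.
    rewrite mderivX mevalZ mnm1E mevalX; case: eqP => [->|_]; rewrite ?mul0r //.
    by rewrite big1 ?mulr1 // => k _; rewrite mnmBE subnn.
  - by rewrite mmapD derivD hornerD mderivD mevalD Eg Eh.
  - rewrite rmorphM derivM hornerD !hornerM mderivM mevalD !mevalM Eg Eh.
    by rewrite !l0.
have l0 : mmap polyC l f = 0 by apply: poly_eq0_horner => x; rewrite lE.
by rewrite -lD l0 deriv0 horner0.
Qed.

(** The value at 0 of the derivative of order [m] is the coefficient at [m] times a product of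
    factorials, which is nonzero in characteristic 0. *)
Lemma mpoly_eq0_meval (K : numDomainType) n (f : {mpoly K[n]}) :
  (forall z, f.@[z] = 0) -> f = 0.
Proof.
move=> f0; apply/mpolyP => m; rewrite mcoeff0.
have dm0 : forall z, (f^`M[m]).@[z] = 0.
  rewrite mderivm_foldr; elim: (flatten _) => //= i s IH.
  exact: mderiv_eq0_meval.
have := mcoeff_mderivm m f 0; rewrite mcoeff0_meval dm0 addm0 => /esym/eqP.
rewrite mulrn_eq0 => /orP[|/eqP//]; rewrite -leqn0 leqNgt => /negP[].
by rewrite prodn_gt0 // => i; rewrite ffact_gt0.
Qed.

(** Up to the factors [w j], the parameters are themselves coordinates, so [I] is the ideal of a
    graph over the coordinates [e j], generated globally by one equation for each other
    coordinate. *)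
Lemma graph_smooth (K : fieldType) m d (I : {mpoly K[m]} -> Prop)
    (e : 'I_d -> 'I_m) (w : 'I_d -> K) (r : m.-tuple {mpoly K[d]}) z :
    (forall j, w j != 0) -> (forall j, tnth r (e j) = w j *: 'X_j) ->
    (forall f, I f <-> f \mPo r = 0) ->
  smooth_at I z.
Proof.
move=> w0 re If.
(* [E] reads each parameter off from its coordinate; it is a section of the substitution of [r]. *)
pose E := comp_mpoly [tuple ((w j)^-1 *: 'X_(e j) : {mpoly K[m]}) | j < d].
have EX j : E 'X_j = (w j)^-1 *: 'X_(e j).
  by rewrite /E comp_mpolyXU -tnth_nth tnth_mktuple.
have EM f h : E (f * h) = E f * E h by rewrite /E rmorphM.
have rM f h : (f * h) \mPo r = (f \mPo r) * (h \mPo r) by rewrite rmorphM.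
pose A := [set i | i \notin codom e].
(* The ideal is generated by the equations [x_i = r_i(x_(e j) / w_j)] of the
   graph, one for each coordinate outside the image of [e]. *)
pose g (k : 'I_#|A|) : {mpoly K[m]} :=
  'X_(enum_val k) - E (tnth r (enum_val k)).
exists #|A|, g; split.
- move=> k; rewrite If /g rmorphB /= comp_mpolyXU -tnth_nth.
  suff -> : E (tnth r (enum_val k)) \mPo r = tnth r (enum_val k) by rewrite subrr.
  elim/mpoly_ring_ind: (tnth r _) => [c|j|f h Ef Eh|f h Ef Eh].
  + by rewrite /E !comp_mpolyC.
  + by rewrite EX comp_mpolyZ comp_mpolyXU -tnth_nth re scalerA mulVf ?scale1r.
  + by rewrite /E !comp_mpolyD -/E Ef Eh.
  + by rewrite EM rmorphM /= Ef Eh.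
(* Modulo the [g k], every polynomial equals its image under [E (_ \mPo r)]. With a prime for this
   image, products follow from fh - f'h' = f (h - h') + h' (f - f'). *)
- have gen f : exists a : 'I_#|A| -> {mpoly K[m]},
      f - E (f \mPo r) = \sum_k a k * g k.
    elim/mpoly_ring_ind: f => [c|i|f h [a Ef] [b Eh]|f h [a Ef] [b Eh]].
    + exists (fun=> 0); rewrite /E !comp_mpolyC subrr.
      by rewrite big1 // => k _; rewrite mul0r.
    + case: (boolP (i \in codom e)) => [/codomP[j ->]|Ai].
        exists (fun=> 0); rewrite comp_mpolyXU -tnth_nth re /E comp_mpolyZ -/E EX.
        rewrite scalerA mulfV // scale1r subrr.
        by rewrite big1 // => k _; rewrite mul0r.
      have iA : i \in A by rewrite inE.
      exists (fun k => (k == enum_rank_in iA i)%:R).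
      rewrite (bigD1 (enum_rank_in iA i)) //= eqxx mul1r big1 => [|k /negPf->].
        by rewrite addr0 /g enum_rankK_in // comp_mpolyXU -tnth_nth.
      by rewrite mul0r.
    + exists (fun k => a k + b k); rewrite /E !comp_mpolyD -/E opprD addrACA.
      by rewrite Ef Eh -big_split; apply: eq_bigr => k _; rewrite mulrDl.
    + exists (fun k => f * b k + E (h \mPo r) * a k).
      transitivity (f * (h - E (h \mPo r)) + E (h \mPo r) * (f - E (f \mPo r))).
        rewrite rM EM !mulrBr [_ * f]mulrC addrA subrK.
        by rewrite [E (h \mPo r) * _]mulrC.
      rewrite Ef Eh !mulr_sumr -big_split; apply: eq_bigr => k _.
      by rewrite mulrDl !mulrA.
  move=> f /If f0; have [a Ea] := gen f.
  exists 1, a; rewrite meval1 oner_neq0 mul1r -Ea f0; split=> //.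
  by rewrite /E comp_mpoly0 subr0.
- have dE i f : i \in A -> (E f)^`M(i) = 0.
    rewrite inE => Ai; elim/mpoly_ring_ind: f => [c|j|f h Ef Eh|f h Ef Eh].
    + by rewrite /E comp_mpolyC mderivC.
    + rewrite EX mderivZ mderivX mnm1E; case: eqP => [eji|_].
        by rewrite -eji codom_f in Ai.
      by rewrite scale0r scaler0.
    + by rewrite /E comp_mpolyD -/E mderivD Ef Eh addr0.
    + by rewrite EM mderivM Ef Eh mul0r mulr0 addr0.
  apply/row_freeP.
  (* The columns of the Jacobian in [A] form the identity, since [E f] involves only the variables
     indexed by [e]. *)
  exists (\matrix_(i < m, k < #|A|) (i == enum_val k)%:R).
  apply/matrixP => k l; rewrite !mxE (bigD1 (enum_val l)) //= big1 => [|i /negPf].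
    rewrite !mxE eqxx mulr1 addr0 mderivB dE ?enum_valP // subr0 mderivX mnm1E.
    rewrite (inj_eq enum_val_inj); case: eqP => [->|_].
      rewrite scale1r mevalX big1 // => i _.
      by rewrite mnmBE subnn expr0.
    by rewrite scale0r meval0.
  by rewrite !mxE => ->; rewrite mulr0.
Qed.

(** * Invariance of smoothness under birational changes of chart *)

Section DirectionalDerivative.

Variables (K : fieldType) (m : nat).
Implicit Types (z v : 'I_m -> K) (f g : {mpoly K[m]}).

Definition dird z v f : K := \sum_j v j * (f^`M(j)).@[z].

Lemma dirdC z v c : dird z v c%:MP = 0.
Proof. by rewrite /dird big1 // => j _; rewrite mderivC meval0 mulr0. Qed.

Lemma dirdX z v i : dird z v 'X_i = v i.
Proof.
rewrite /dird (bigD1 i) //= big1 => [|j /negPf ji].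
  rewrite addr0 mderivX mnm1E eqxx scale1r mevalX big1 ?mulr1 // => k _.
  by rewrite mnmBE subnn.
by rewrite mderivX mnm1E eq_sym ji scale0r meval0 mulr0.
Qed.

Lemma dirdD z v f g : dird z v (f + g) = dird z v f + dird z v g.
Proof.
by rewrite -big_split; apply: eq_bigr => j _; rewrite mderivD mevalD mulrDr.
Qed.

Lemma dirdM z v f g :
  dird z v (f * g) = dird z v f * g.@[z] + f.@[z] * dird z v g.
Proof.
rewrite mulr_suml mulr_sumr -big_split; apply: eq_bigr => j _ /=.
by rewrite mderivM mevalD !mevalM; ring.
Qed.

Lemma dird_exp z v f k :
  dird z v (f ^+ k) = k%:R * f.@[z] ^+ k.-1 * dird z v f.
Proof.
elim: k => [|k IH]; first by rewrite expr0 -mpolyC1 dirdC !mul0r.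
rewrite exprS dirdM IH rmorphXn /= -[k.+1]addn1 natrD.
by case: k {IH} => [|k]; rewrite ?expr0 ?exprS /=; ring.
Qed.

Lemma eq_dird z1 z2 v f : z1 =1 z2 -> dird z1 v f = dird z2 v f.
Proof. by move=> ez; apply: eq_bigr => j _; rewrite (meval_eq _ ez). Qed.

End DirectionalDerivative.

Section RationalMap.

Variables (K : fieldType) (m m' : nat) (q : {mpoly K[m]}).
Variable (r : 'I_m' -> {mpoly K[m]}).

Definition ratmap (x : 'I_m -> K) j := (r j).@[x] / q.@[x].

(* The differential of [ratmap], by the quotient rule. *)
Definition dratmap (z v : 'I_m -> K) j :=
  (dird z v (r j) - ratmap z j * dird z v q) / q.@[z].

(** The exponent is free above a bound, so that the two terms of a sum can share it. The identity
    between values covers the zeros of [q] too, where [ratmap] is 0 because division by 0 gives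
    0. *)
Lemma ratmap_pullback (f' : {mpoly K[m']}) :
  exists N0, forall N, (N0 <= N)%N -> exists f : {mpoly K[m]},
    (forall x, f.@[x] = q.@[x] ^+ N * f'.@[ratmap x]) /\
    (forall z v, q.@[z] != 0 -> dird z v f =
       q.@[z] ^+ N * dird (ratmap z) (dratmap z v) f' +
       N%:R * q.@[z] ^+ N.-1 * dird z v q * f'.@[ratmap z]).
Proof.
elim/mpoly_ring_ind: f' => [c|j|f g [A PA] [B PB]|f g [A PA] [B PB]].
- exists 0%N => N _; exists (c%:MP * q ^+ N); split=> [x|z v _].
    by rewrite mevalM !mevalC rmorphXn mulrC.
  by rewrite dirdM !dirdC !mevalC dird_exp; ring.
(* Exponent 1 would give [r j], which need not vanish where [q] does. *)
- exists 2%N => -[|[|k]] // _; exists (r j * q ^+ k.+1); split=> [x|z v qz].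
    rewrite mevalM mevalXU rmorphXn /= /ratmap.
    have [->|qx] := eqVneq q.@[x] 0; first by rewrite !exprS !mul0r mulr0.
    by rewrite !exprS; field.
  rewrite dirdM dird_exp dirdX mevalXU /dratmap /ratmap rmorphXn /=.
  have -> : k.+2%:R = k.+1%:R + 1 :> K by rewrite -addn1 natrD.
  by rewrite !exprS; field.
- exists (maxn A B) => N; rewrite geq_max => /andP[/PA[a [aE aD]] /PB[b [bE bD]]].
  exists (a + b); split=> [x|z v qz]; first by rewrite !mevalD aE bE mulrDr.
  by rewrite !dirdD aD // bD // mevalD; ring.
- exists (A + B)%N => N AB.
  have [a [aE aD]] := PA A (leqnn A).
  have [|b [bE bD]] := PB (N - A)%N; first by lia.
  have := subnKC (leq_trans (leq_addr B A) AB).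
  move: (N - A)%N b bE bD => B' b bE bD <-.
  exists (a * b); split=> [x|z v qz]; first by rewrite !mevalM aE bE exprD; ring.
  rewrite !dirdM aD // bD // aE bE !mevalM exprD natrD.
  case: A {aE aD PA AB} => [|A]; case: B' {bE bD} => [|B'];
    by rewrite ?addn0 ?add0n ?addSn ?addnS /= ?expr0 ?exprS ?exprD; ring.
Qed.

End RationalMap.

Section Transition.

Variables (K : numFieldType) (m m' : nat).
Variables (q : {mpoly K[m]}) (r : 'I_m' -> {mpoly K[m]}).
Variables (q' : {mpoly K[m']}) (r' : 'I_m -> {mpoly K[m']}).
Local Notation phi := (ratmap q r).
Local Notation psi := (ratmap q' r').
Hypothesis phiK : forall x, q.@[x] != 0 -> q'.@[phi x] != 0 /\ psi (phi x) =1 x.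
Hypothesis psiK : forall x, q'.@[x] != 0 -> q.@[psi x] != 0 /\ phi (psi x) =1 x.

Lemma dratmap_surj z w : q.@[z] != 0 -> exists v, dratmap q r z v =1 w.
Proof.
move=> qz; have [qz' zK] := phiK qz; set z' := phi z in qz' zK *.
exists (dratmap q' r' z' w) => j; set v := dratmap q' r' z' w.
(* [r j - z'_j q] vanishes at [z] and becomes [(x'_j - z'_j) q] after the
   substitution [x = psi x']; its derivative is computed in both ways. *)
pose f1 := r j - (z' j)%:MP * q.
have f1z : f1.@[z] = 0.
  by rewrite /f1 mevalB mevalM mevalC /z' /ratmap divfK // subrr.
have -> : dratmap q r z v j = dird z v f1 / q.@[z].
  rewrite /f1 -mulNr -mpolyCN dirdD dirdM dirdC mevalC /dratmap -/z'.
  by rewrite -/z' mul0r add0r mulNr.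
suff -> : dird z v f1 = w j * q.@[z] by rewrite mulfK.
have [A PA] := ratmap_pullback q' r' f1; have [B PB] := ratmap_pullback q' r' q.
(* A positive exponent makes [F] and [Q] vanish wherever [q'] does. *)
pose N := (maxn A B).+1.
have [|F [FE FD]] := PA N; first by rewrite leqW // leq_maxl.
have [|Q [QE QD]] := PB N; first by rewrite leqW // leq_maxr.
have EF : F = ('X_j - (z' j)%:MP) * Q.
  apply/eqP; rewrite -subr_eq0; apply/eqP/mpoly_eq0_meval => x.
  rewrite mevalB mevalM mevalB mevalXU mevalC FE QE.
  have [->|qx] := eqVneq q'.@[x] 0; first by rewrite exprS !mul0r mulr0 subrr.
  have [qp /(_ j) xj] := psiK qx; rewrite /f1 mevalB mevalM mevalC.
  have -> : (r j).@[psi x] = x j * q.@[psi x] by rewrite -xj divfK.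
  ring.
have EdF : dird z' w F = w j * Q.@[z'].
  rewrite EF dirdM dirdD dirdX -mpolyCN dirdC mevalD mevalXU mevalC.
  by rewrite subrr mul0r addr0 addr0.
have := FD z' w qz'; rewrite EdF QE !(meval_eq _ zK) f1z mulr0 addr0.
rewrite (eq_dird _ _ zK) -/v mulrCA => /(mulfI _) -> //.
by rewrite expf_neq0.
Qed.

Variables (X : ('I_m -> K) -> Prop) (X' : ('I_m' -> K) -> Prop).
Hypothesis X_phi : forall x, X x -> q.@[x] != 0 -> X' (phi x).
Hypothesis X_psi : forall x, X' x -> q'.@[x] != 0 -> X (psi x).
Local Notation I := (fun f : {mpoly K[m]} => forall x, X x -> f.@[x] = 0).
Local Notation I' := (fun f : {mpoly K[m']} => forall x, X' x -> f.@[x] = 0).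

(** [I] and [I'] are the vanishing ideals of sets that correspond where [q] and [q'] are nonzero.
    Generators are pulled back and cleared of denominators; their differentials stay independent
    because the differential of [phi] is onto. *)
Lemma smooth_at_transition z :
  q.@[z] != 0 -> zero_locus I z -> smooth_at I' (phi z) -> smooth_at I z.
Proof.
move=> qz zI [c [g' [Ig' gen rf]]].
have /fin_all_exists2[] : forall i, exists2 g : {mpoly K[m]} * nat,
     (forall x, g.1.@[x] = q.@[x] ^+ g.2.+1 * (g' i).@[phi x]) &
     (forall z v, q.@[z] != 0 -> dird z v g.1 =
       q.@[z] ^+ g.2.+1 * dird (phi z) (dratmap q r z v) (g' i) +
       g.2.+1%:R * q.@[z] ^+ g.2 * dird z v q * (g' i).@[phi z]).
  move=> i; have [N PN] := ratmap_pullback q r (g' i).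
  by have [g [gE gD]] := PN N.+1 (leqnSn N); exists (g, N).
move=> g gE gD.
have Ig i : I (g i).1.
  move=> x Xx; rewrite gE; have [->|qx] := eqVneq q.@[x] 0.
    by rewrite exprS !mul0r.
  by rewrite (Ig' i) ?mulr0 //; apply: X_phi.
exists c, (fun i => (g i).1); split=> //.
- move=> f If.
  have [A PA] := ratmap_pullback q' r' f.
  have [f' [fE _]] := PA A.+1 (leqnSn A).
  have [|h' [a' [h'z Ea]]] := gen f'.
    move=> x Xx; rewrite fE; have [->|qx] := eqVneq q'.@[x] 0.
      by rewrite exprS !mul0r.
    by rewrite If ?mulr0 //; apply: X_psi.
  have [B PB] := ratmap_pullback q r (h' * q' ^+ A.+1).
  have /fin_all_exists[C PC] := fun i => ratmap_pullback q r (a' i).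
  (* A power of [q] that clears all denominators at once; being positive, it makes the final
     identity trivial at the zeros of [q]. *)
  pose T := (B + \sum_i (C i + (g i).2).+2).+1.
  have TB : (B <= T)%N by rewrite leqW // leq_addr.
  have TC i : (C i + (g i).2.+1 < T)%N.
    by rewrite /T (bigD1 i) //=; lia.
  have [h [hE _]] := PB T TB.
  have /fin_all_exists[a aE] i : exists a : {mpoly K[m]},
      forall x, a.@[x] = q.@[x] ^+ (T - (g i).2.+1) * (a' i).@[phi x].
    have [|a [aE _]] := PC i (T - (g i).2.+1)%N; last by exists a.
    by have := TC i; lia.
  exists h, a; split.
    have [qz' _] := phiK qz.
    by rewrite hE !mulf_neq0 ?expf_neq0 // mevalM rmorphXn mulf_neq0 ?expf_neq0.
  apply/eqP; rewrite -subr_eq0; apply/eqP/mpoly_eq0_meval => x.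
  rewrite mevalB mevalM hE.
  have -> : (\sum_(i < c) a i * (g i).1).@[x] =
            q.@[x] ^+ T * (\sum_i a' i * g' i).@[phi x].
    rewrite !raddf_sum mulr_sumr; apply: eq_bigr => i _ /=.
    have giT : ((g i).2.+1 <= T)%N by have := TC i; lia.
    rewrite !mevalM aE gE -[in RHS](subnK giT).
    by rewrite exprD; ring.
  rewrite -Ea mevalM [(h' * _).@[_]]mevalM rmorphXn fE /=.
  have [q0|qx] := eqVneq q.@[x] 0.
    by rewrite q0 /T exprS !mul0r subrr.
  by have [_ xK] := phiK qx; rewrite (meval_eq _ xK); ring.
- have /row_freeP[V VE] := rf.
  (* The columns of a right inverse of the Jacobian of [g'] are lifted through the differential of
     [phi]; the scalar cancels the power of [q] in the differential of [g k]. *)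
  have /fin_all_exists[v vE] k : exists v, dratmap q r z v =1
      fun j => (q.@[z] ^+ (g k).2.+1)^-1 * V j k by exact: dratmap_surj.
  apply/row_freeP; exists (\matrix_(j, k) v k j); apply/matrixP => i k.
  have -> : (\matrix_(i, j) ((g i).1^`M(j)).@[z] *m \matrix_(j, k) v k j) i k
            = dird z (v k) (g i).1.
    by rewrite mxE; apply: eq_bigr => j _; rewrite !mxE mulrC.
  rewrite gD //.
  have -> : (g' i).@[phi z] = 0.
    have [qN] : q.@[z] ^+ (g i).2.+1 != 0 by rewrite expf_neq0.
    by apply: (mulfI qN); rewrite -gE mulr0; apply: zI (Ig i).
  have := congr1 (fun M : 'M_c => M i k) VE; rewrite !mxE mulr0 addr0 => <-.
  have -> : dird (phi z) (dratmap q r z (v k)) (g' i) =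
      (q.@[z] ^+ (g k).2.+1)^-1 *
      \sum_j (\matrix_(i, j) ((g' i)^`M(j)).@[phi z]) i j * V j k.
    rewrite mulr_sumr; apply: eq_bigr => j _.
    by rewrite vE mxE -mulrA [V j k * _]mulrC.
  have := congr1 (fun M : 'M_c => M i k) VE; rewrite !mxE => ->.
  case: eqP => [->|_]; last by rewrite !mulr0.
  by rewrite mulr1 mulfV // expf_neq0.
Qed.

End Transition.

(** * Maximal minors *)

Definition upd (p : nat) (T : Type) (g : {ffun 'I_p -> T}) (i : 'I_p) (j : T) :
    {ffun 'I_p -> T} := [ffun a => if a == i then j else g a].

Section ColumnMinors.

Variables (p n : nat).
Implicit Types (f g : {ffun 'I_p -> 'I_n}) (i : 'I_p) (j : 'I_n).

(** Unsorted sequences and repetitions are allowed, so that exchanging a single column needs no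
    resorting. *)
Definition cdet (R : comPzRingType) g (x : 'M[R]_(p, n)) : R :=
  \det (colsub g x).

Lemma cdet_mull (R : comPzRingType) (A : 'M[R]_p) (x : 'M[R]_(p, n)) g :
  cdet g (A *m x) = \det A * cdet g x.
Proof. by rewrite /cdet -det_mulmx mulmx_colsub. Qed.

Lemma cdet_diagr (R : comPzRingType) (d : 'I_n -> R) (x y : 'M[R]_(p, n)) g :
  (forall i j, y i j = x i j * d j) -> cdet g y = (\prod_i d (g i)) * cdet g x.
Proof.
move=> yE; transitivity (\det (colsub g x *m diag_mx (\row_i d (g i)))).
  congr (\det _); apply/matrixP => i k; rewrite !mxE (bigD1 k) //= big1.
    by rewrite !mxE eqxx mulr1n addr0 yE.
  by move=> l /negPf lk; rewrite !mxE lk mulr0n mulr0.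
rewrite det_mulmx det_diag mulrC; congr (_ * _).
by apply: eq_bigr => i _; rewrite mxE.
Qed.

Lemma cdet_map (R S : comPzRingType) (h : {rmorphism R -> S})
    (x : 'M[R]_(p, n)) g :
  cdet g (map_mx h x) = h (cdet g x).
Proof. by rewrite /cdet -det_map_mx map_mxsub. Qed.

Lemma cdet_upd_expand (R : comPzRingType) (x : 'M[R]_(p, n)) g i j :
  cdet (upd g i j) x = \sum_k x k j * cofactor (colsub g x) k i.
Proof.
rewrite /cdet (expand_det_col _ i); apply: eq_bigr => k _.
rewrite !mxE ffunE eqxx; congr (_ * (_ * \det _)).
by apply/matrixP => u v; rewrite !mxE ffunE eq_sym (negPf (neq_lift _ _)).
Qed.

Lemma cramer (R : comPzRingType) (x : 'M[R]_(p, n)) f k j :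
  cdet f x * x k j = \sum_i x k (f i) * cdet (upd f i j) x.
Proof.
have /(congr1 (fun M : 'M_p => (M *m col j x) k 0)) := mul_mx_adj (colsub f x).
rewrite mul_scalar_mx -mulmxA !mxE => <-; apply: eq_bigr => i _.
rewrite cdet_upd_expand !mxE; congr (_ * _).
by apply: eq_bigr => l _; rewrite !mxE mulrC.
Qed.

(** The quadratic Pluecker relation: expand the minor [g] along its column [q] and apply Cramer's
    rule to the entries of that column. *)
Lemma cdet_exchange (R : comPzRingType) (x : 'M[R]_(p, n)) f g q :
  cdet f x * cdet g x =
  \sum_i cdet (upd f i (g q)) x * cdet (upd g q (f i)) x.
Proof.
have {1}-> : g = upd g q (g q).
  by apply/ffunP => a; rewrite ffunE; case: eqP => // ->.
rewrite cdet_upd_expand mulr_sumr.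
under eq_bigr do rewrite mulrA cramer mulr_suml.
rewrite exchange_big; apply: eq_bigr => i _ /=.
rewrite [cdet (upd g q _) x]cdet_upd_expand mulr_sumr.
apply: eq_bigr => k _.
by rewrite [x k _ * _]mulrC mulrA.
Qed.

Lemma cdet_noninj (R : comPzRingType) (x : 'M[R]_(p, n)) g (a b : 'I_p) :
  a != b -> g a = g b -> cdet g x = 0.
Proof.
move=> ab gab; rewrite /cdet -det_tr; apply: (determinant_alternate ab) => k.
by rewrite !mxE gab.
Qed.

Lemma cdet_perm (R : comPzRingType) (x : 'M[R]_(p, n)) f g (s : 'S_p) :
  (forall a, g a = f (s a)) -> cdet g x = (-1) ^+ s * cdet f x.
Proof.
move=> gf; have -> : cdet g x = \det (col_perm s (colsub f x)).
  by congr (\det _); apply/matrixP => i k; rewrite !mxE gf.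
by rewrite col_permE det_mulmx det_perm mulrC odd_permV.
Qed.

Definition normal (R : pzRingType) f (x : 'M[R]_(p, n)) :=
  forall i a, x i (f a) = (i == a)%:R.

Lemma normal_cdet (R : comPzRingType) f (x : 'M[R]_(p, n)) :
  normal f x -> cdet f x = 1.
Proof.
move=> fx; rewrite -(det1 R p); congr (\det _).
by apply/matrixP => i k; rewrite !mxE fx.
Qed.

Lemma normal_cdet_upd (R : comPzRingType) f (x : 'M[R]_(p, n)) i j :
  normal f x -> cdet (upd f i j) x = x i j.
Proof.
move=> fx; have := cramer x f i j; rewrite normal_cdet // mul1r => ->.
rewrite (bigD1 i) //= fx eqxx mul1r big1 ?addr0 // => k /negPf ki.
by rewrite fx eq_sym ki mul0r.
Qed.

Lemma sort_injective f : injective f ->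
  exists (I : plucker_index p n) (s : 'S_p), forall a, f a = val I (s a).
Proof.
move=> f_inj; pose geo : rel 'I_n := fun a b => (b <= a)%N.
have geo_total : total geo by move=> a b; apply: leq_total.
have geo_trans : transitive geo by move=> a b c ba cb; apply: leq_trans cb ba.
pose t := sort_tuple geo [tuple f a | a < p].
have /tuple_permP[s sE] : perm_eq [tuple f a | a < p] t.
  by rewrite perm_sym perm_sort.
have tE a : f a = tnth t (s a).
  transitivity (tnth [tuple f a | a < p] a); first by rewrite tnth_mktuple.
  by rewrite (tnth_nth (f a)) sE -tnth_nth tnth_mktuple.
have t_uniq : uniq t.
  by rewrite sort_uniq map_inj_uniq ?enum_uniq.
have t_dec (a b : 'I_p) : (a < b)%N -> (tnth t b < tnth t a)%N.
  move=> ab; rewrite ltn_neqAle; apply/andP; split.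
    have := ab; rewrite ltn_neqAle => /andP[/eqP nab _].
    apply: contra_notN nab => /eqP/val_inj/(tuple_uniqP _ t_uniq) ->.
    by [].
  rewrite !(tnth_nth (f a)).
  apply: (sorted_ltn_nth geo_trans) => //; rewrite ?inE ?size_tuple //.
  exact: sort_sorted.
pose I := [ffun a => tnth t a].
have Idec : [forall a : 'I_p, forall b : 'I_p, (a < b)%N ==> (I b < I a)%N].
  apply/forallP => a; apply/forallP => b; apply/implyP => ab.
  by rewrite !ffunE t_dec.
by exists (exist _ I Idec), s => a; rewrite /= ffunE.
Qed.

Lemma plucker_index_inj (I : plucker_index p n) : injective (val I).
Proof.
move=> a b Iab; apply/eqP/negPn/negP => ab.
have /forallP Idec := valP I.
have [ab'|ab'|/val_inj/eqP] := ltngtP a b; last by rewrite (negPf ab).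
  by have /forallP/(_ b)/implyP/(_ ab') := Idec a; rewrite Iab ltnn.
by have /forallP/(_ a)/implyP/(_ ab') := Idec b; rewrite Iab ltnn.
Qed.

End ColumnMinors.

(** * Pivoting *)

Section Pivots.

Variables (p n : nat) (col : pred 'I_n).
Implicit Types (f g : {ffun 'I_p -> 'I_n}) (i r : 'I_p) (j b : 'I_n).

Definition cnt g := #|[set a | col (g a)]|.

Lemma cnt_upd g i j : ~~ col (g i) -> col j -> cnt (upd g i j) = (cnt g).+1.
Proof.
move=> gi cj; rewrite /cnt -[RHS]add1n (cardsD1 i) inE ffunE eqxx cj; congr addn.
apply: eq_card => a; rewrite !inE ffunE; case: (eqVneq a i) => [->|//].
by rewrite (negPf gi).
Qed.

Lemma cnt_upd_eq g i j : col (g i) = col j -> cnt (upd g i j) = cnt g.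
Proof.
move=> gi; apply: eq_card => a; rewrite !inE ffunE.
by case: (eqVneq a i) => [->|].
Qed.

(* [M'] spans the plane obtained from the row space of [M] by dividing the colored
   columns by [t]; it stays meaningful where [t] vanishes. *)
Lemma pivot (R : idomainType) f (M : 'M[R]_(p, n)) r b t
    (H : 'I_p -> 'I_n -> R) :
    normal f M -> ~~ col (f r) -> col b -> t != 0 -> H r b = 1 ->
    (forall i j, ~~ col (f i) -> col j -> M i j = t * H i j) ->
  exists M' : 'M[R]_(p, n), [/\ normal (upd f r b) M',
    forall i j, i != r -> ~~ col (f i) -> col j ->
      M' i j = H i j - H i b * H r j
    & forall g, t ^+ cnt f * cdet g M = t ^+ cnt g * cdet g M'].
Proof.
move=> fM fr cb t0 Hrb MH.
pose w i := if col (f i) then M i b else H i b.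
pose M' : 'M[R]_(p, n) := \matrix_(i, j)
  if i == r then (if col j then H r j else M r j)
  else if col (f i) then
    (if col j then M i j - w i * H r j else t * M i j - w i * M r j)
  else (if col j then H i j - w i * H r j else M i j - w i * M r j).
(* Row operations that clear column [b] with row [r]: [D *m M] is [M'] with the colored columns
   multiplied by [t]. *)
pose D : 'M[R]_p := \matrix_(i, k)
  if i == r then (k == r)%:R
  else (if col (f i) then t else 1) *+ (i == k) - w i *+ (k == r).
have HrF a : a != r -> col (f a) -> H r (f a) = 0.
  move=> ar cfa; apply: (mulfI t0).
  by rewrite -MH // fM eq_sym (negPf ar) mulr0.
have M'n : normal (upd f r b) M'.
  move=> i a; rewrite mxE !ffunE; have [->|ir] := eqVneq i r.
    have [_|ar] := eqVneq a r; first by rewrite cb Hrb.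
    case: ifP => cfa; first exact: HrF.
    by rewrite fM eq_sym (negPf ar).
  have [->|ar] := eqVneq a r.
    rewrite cb (negPf ir) Hrb mulr1 /w.
    by case: (col (f i)); rewrite subrr.
  rewrite !fM [r == a]eq_sym (negPf ar) !mulr0.
  case: ifP => cfi; case: ifP => cfa; rewrite ?HrF // ?mulr0 ?subr0 //.
    case: (eqVneq i a) => [eia|_]; last by rewrite mulr0.
    by rewrite eia cfa in cfi.
  apply: (mulfI t0); rewrite -MH ?cfi // fM.
  case: (eqVneq i a) => [eia|_]; last by rewrite mulr0.
  by rewrite eia cfa in cfi.
have DM i j : (D *m M) i j = M' i j * (if col j then t else 1).
  have MHr : col j -> M r j = t * H r j by move=> cj; rewrite MH.
  rewrite !mxE; have [->|ir] := eqVneq i r.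
    rewrite (bigD1 r) //= !mxE !eqxx mul1r big1 ?addr0.
      by case: ifP => [/MHr->|_]; ring.
    by move=> k /negPf kr; rewrite !mxE eqxx kr mul0r.
  transitivity ((if col (f i) then t else 1) * M i j - w i * M r j).
    rewrite (bigD1 i) //= (bigD1 r) 1?eq_sym //= big1 ?addr0.
      rewrite !mxE (negPf ir) !eqxx /= !mulr1n mulr0n subr0.
      by congr (_ + _); rewrite mulr0n sub0r mulNr.
    move=> k /andP[ki kr].
    by rewrite !mxE (negPf ir) eq_sym (negPf ki) (negPf kr) subr0 mul0r.
  by case: ifP => cfi; case: ifP => cj;
    rewrite ?(MHr cj) ?(MH i j (negbT cfi) cj); ring.
have detD g : \det D * cdet g M = t ^+ cnt g * cdet g M'.
  rewrite -cdet_mull (cdet_diagr g DM); congr (_ * _).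
  rewrite -big_mkcond /= prodr_const; congr (_ ^+ _).
  by apply: eq_card => a; rewrite !inE.
(* [detD] is applied to [upd f r b], whose minor is [t] in [M] and 1 in [M']. *)
have detDE : \det D = t ^+ cnt f.
  apply: (mulIf t0); have := detD (upd f r b).
  rewrite normal_cdet_upd // MH // Hrb mulr1 normal_cdet // mulr1.
  by rewrite cnt_upd // exprSr.
exists M'; split=> // [i j ir cfi cj|g]; last by rewrite -detDE detD.
by rewrite mxE (negPf ir) (negPf cfi) cj /w (negPf cfi).
Qed.

End Pivots.

(** * Chains of pivots and the L D U expansion *)

Section PivotChains.

Variables (p n : nat).
Implicit Types (f g : {ffun 'I_p -> 'I_n}) (i : 'I_p) (j : 'I_n).
Implicit Types (u : 'I_p * 'I_n) (ps : seq ('I_p * 'I_n)).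

Definition run f ps := foldl (fun g u => upd g u.1 u.2) f ps.

Variable col : pred 'I_n.

Definition live_col f j := col j && (j \notin codom f).

Fixpoint valid f ps :=
  if ps is u :: ps' then
    [&& ~~ col (f u.1), live_col f u.2 & valid (upd f u.1 u.2) ps']
  else true.

Definition exhausted f := (forall i, col (f i)) \/ (forall j, ~~ live_col f j).

Lemma live_row_upd f u i : ~~ col (f u.1) -> col u.2 ->
  ~~ col (upd f u.1 u.2 i) = (i != u.1) && ~~ col (f i).
Proof. by move=> fu cu; rewrite ffunE; case: eqP => // _; rewrite cu. Qed.

Lemma live_col_upd f u j : ~~ col (f u.1) ->
  live_col (upd f u.1 u.2) j = (j != u.2) && live_col f j.
Proof.
move=> fu; rewrite /live_col andbCA; case cj: (col j) => //=.
apply/idP/andP => [jN|[ju jN]].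
  split.
    apply: contraNneq jN => ->; apply/codomP; exists u.1.
    by rewrite ffunE eqxx.
  apply: contraNN jN => /codomP[a ja]; apply/codomP; exists a; rewrite ffunE.
  by case: eqP => // au; rewrite -au -ja cj in fu.
apply: contraNN jN => /codomP[a ja]; apply/codomP; exists a; move: ja ju.
by rewrite ffunE; case: eqP => // _ ->; rewrite eqxx.
Qed.

Lemma valid_catl f ps1 ps2 : valid f (ps1 ++ ps2) -> valid f ps1.
Proof. by elim: ps1 f => //= u ps1 IH f /and3P[-> ->]; apply: IH. Qed.

Lemma valid_catr f ps1 ps2 : valid f (ps1 ++ ps2) -> valid (run f ps1) ps2.
Proof. by elim: ps1 f => //= u ps1 IH f /and3P[_ _]; apply: IH. Qed.

Lemma cnt_run f ps : valid f ps -> cnt col (run f ps) = (cnt col f + size ps)%N.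
Proof.
elim: ps f => [|u ps IH] f /=; first by rewrite addn0.
case/and3P=> fu /andP[cu _] /IH->.
by rewrite cnt_upd // addSnnS.
Qed.

(** The first pivot is set apart because its parameter is the overall scale; the expansion itself
    has entry 1 there. *)
Definition off_head ps i j := if ps is u :: _ then (i, j) != u else true.

Section Expansion.

Variables (R : comPzRingType) (th : 'I_p -> 'I_n -> R).

(* [head_scale ps * expansion f ps] is a product L D U, with pivots in the order
   given by [ps]: the unipotent factors have entries [th i u.2] and [th u.1 j],
   and the diagonal of [D] is [t_0, t_0 t_1, t_0 t_1 t_2, ...]. For a pivot [v]
   preceded by a pivot [u], the parameter [th v.1 v.2] is not the scale itself but
   its sum with [th v.1 u.2 * th u.1 v.2], which is a ratio of minors. *)
Definition next_scale u ps :=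
  if ps is v :: _ then th v.1 v.2 - th v.1 u.2 * th u.1 v.2 else 1.

Definition head_scale ps := if ps is u :: _ then th u.1 u.2 else 0.

Fixpoint expansion f ps i j : R :=
  if ps is u :: ps' then
    (if i == u.1 then 1 else if col (f i) then 0 else th i u.2) *
    (if j == u.2 then 1 else if live_col f j then th u.1 j else 0) +
    next_scale u ps' * expansion (upd f u.1 u.2) ps' i j
  else 0.

Lemma expansion_row0 f ps i j :
  valid f ps -> col (f i) -> expansion f ps i j = 0.
Proof.
elim: ps f => //= u ps IH f /and3P[fu /andP[cu _] vf] cfi.
have /negPf iu : i != u.1 by apply: contraNneq fu => <-.
by rewrite iu cfi mul0r add0r IH ?mulr0 // ffunE iu.
Qed.

Lemma expansion_col0 f ps i j :
  valid f ps -> ~~ live_col f j -> expansion f ps i j = 0.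
Proof.
elim: ps f => //= u ps IH f /and3P[fu cu vf] cfj.
have /negPf ju : j != u.2 by apply: contraNneq cfj => ->.
rewrite ju (negPf cfj) mulr0 add0r IH ?mulr0 // live_col_upd //.
by rewrite (negPf cfj) andbF.
Qed.

Lemma expansion_pivot_row f u ps j : valid f (u :: ps) ->
  expansion f (u :: ps) u.1 j =
  if j == u.2 then 1 else if live_col f j then th u.1 j else 0.
Proof.
move=> /= /and3P[fu /andP[cu _] vf].
by rewrite eqxx mul1r expansion_row0 ?mulr0 ?addr0 // ffunE eqxx.
Qed.

Lemma expansion_pivot_col f u ps i : valid f (u :: ps) ->
  expansion f (u :: ps) i u.2 =
  if i == u.1 then 1 else if col (f i) then 0 else th i u.2.
Proof.
move=> /= /and3P[fu _ vf].
by rewrite eqxx mulr1 expansion_col0 ?mulr0 ?addr0 // live_col_upd // eqxx.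
Qed.

Lemma expansion_pivot f u ps : valid f (u :: ps) ->
  expansion f (u :: ps) u.1 u.2 = 1.
Proof. by move=> vf; rewrite expansion_pivot_row // eqxx. Qed.

(** Eliminating the first pivot removes exactly the rank one term, which leaves the expansion of the
    remaining pivots, rescaled. *)
Lemma expansion_schur f u ps i j : valid f (u :: ps) ->
  expansion f (u :: ps) i j
    - expansion f (u :: ps) i u.2 * expansion f (u :: ps) u.1 j =
  next_scale u ps * expansion (upd f u.1 u.2) ps i j.
Proof.
move=> vf; rewrite expansion_pivot_row // expansion_pivot_col //=.
by rewrite addrAC subrr add0r.
Qed.

End Expansion.

Lemma eq_expansion (R : comPzRingType) (th th' : 'I_p -> 'I_n -> R) f ps :
    valid f ps ->
    (forall i j, ~~ col (f i) -> live_col f j ->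
       off_head ps i j -> th i j = th' i j) ->
  expansion th f ps =2 expansion th' f ps.
Proof.
elim: ps f => //= u ps IH f /and3P[fu cu vf] eth i j.
have cu2 : col u.2 by case/andP: cu.
congr (_ * _ + _ * _).
- case: eqP => // /eqP iu; case: ifP => // /negbT fi; apply: eth => //.
  by case: (u) iu => a b /=; apply: contraNneq => -[->].
- case: eqP => // /eqP ju; case: ifP => // fj; apply: eth => //.
  by case: (u) ju => a b /=; apply: contraNneq => -[->].
- case: ps IH vf => //= v ps _ /and3P[].
  rewrite live_row_upd // => /andP[vu fv]; rewrite live_col_upd // => /andP[vu2 cv] _.
  rewrite !eth //.
  + by case: (u) vu2 => a b /=; apply: contraNneq => -[->].
  + by case: (u) vu => a b /=; apply: contraNneq => -[->].
  + by case: (u) vu => a b /=; apply: contraNneq => -[->].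
apply: IH => // k l; rewrite live_row_upd // => /andP[ku fk].
rewrite live_col_upd // => /andP[lu cl] _; apply: eth => //.
by case: (u) ku => a b /=; apply: contraNneq => -[->].
Qed.

(** The parameter appears at the stage whose pivot lies in row [i] or column [j]. If [(i, j)] is
    itself a pivot, it appears one stage earlier, where the product subtracted in [next_scale] is
    added back. *)
Lemma expansion_coord (R : comPzRingType) (th : 'I_p -> 'I_n -> R) f ps i j :
    valid f ps -> exhausted (run f ps) ->
    ~~ col (f i) -> live_col f j -> off_head ps i j ->
  exists ps1 u ps2, [/\ ps = ps1 ++ u :: ps2, ~~ col (run f ps1 i),
    live_col (run f ps1) j & expansion th (run f ps1) (u :: ps2) i j = th i j].
Proof.
elim: ps f => [|u ps IH] f.
  by move=> _ [/(_ i)->|/(_ j)/negP].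
move=> vuf; have [fu cu vf] := and3P vuf; have cu2 : col u.2 by case/andP: cu.
move=> ex fi cj ij.
have [iu|iu] := eqVneq i u.1.
  exists [::], u, ps; split=> //; rewrite -[run f [::]]/f iu expansion_pivot_row //.
  case: eqP => [ju|_]; last by rewrite cj.
  by rewrite /off_head iu ju -surjective_pairing eqxx in ij.
have [ju|ju] := eqVneq j u.2.
  exists [::], u, ps; split=> //; rewrite -[run f [::]]/f ju expansion_pivot_col //.
  by rewrite (negPf iu) (negPf fi).
have fi' : ~~ col (upd f u.1 u.2 i) by rewrite live_row_upd // iu.
have cj' : live_col (upd f u.1 u.2) j by rewrite live_col_upd // ju.
have [offv|] := boolP (off_head ps i j).
  have [ps1 [v [ps2 [-> fi1 cj1 E]]]] := IH _ vf ex fi' cj' offv.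
  by exists (u :: ps1), v, ps2.
case: ps IH vf ex vuf {ij} => // v ps IH vf ex vuf /negPn/eqP ijv.
exists [::], u, (v :: ps); split=> //.
have [iv jv] : i = v.1 /\ j = v.2 by rewrite -ijv.
rewrite -[run f [::]]/f; have /eqP := expansion_schur th i j vuf.
rewrite {3}iv {3}jv expansion_pivot // mulr1 subr_eq => /eqP ->.
rewrite expansion_pivot_row // expansion_pivot_col //.
by rewrite (negPf iu) (negPf ju) (negPf fi) cj /= iv jv subrK.
Qed.

Lemma map_expansion (R S : comPzRingType) (h : {rmorphism R -> S})
    (th : 'I_p -> 'I_n -> R) f ps i j :
  h (expansion th f ps i j) = expansion (fun i j => h (th i j)) f ps i j.
Proof.
elim: ps f => [|u ps IH] f /=; first exact: rmorph0.
rewrite rmorphD rmorphM rmorphM IH; congr (_ * _ + _ * _).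
- by do 2?[case: ifP => _]; rewrite ?rmorph1 ?rmorph0.
- by do 2?[case: ifP => _]; rewrite ?rmorph1 ?rmorph0.
- by case: ps {IH} => [|v ps] /=; rewrite ?rmorph1 // rmorphB rmorphM.
Qed.

Fixpoint nondegenerate (R : comPzRingType) (th : 'I_p -> 'I_n -> R) ps :=
  if ps is u :: ps' then next_scale th u ps' != 0 /\ nondegenerate th ps'
  else True.

Section Factorization.

Variables (R : idomainType) (th : 'I_p -> 'I_n -> R).

(** Iteration of [pivot]. The factor [m] is common to all minors with the same number of colored
    columns: [e = 0] yields divisibility by the leading minor, [e = 1] expresses the parameters as
    ratios of minors. *)
Lemma pivot_chain f ps (M : 'M[R]_(p, n)) t :
    valid f ps -> nondegenerate th ps -> normal f M -> t != 0 ->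
    (forall i j, ~~ col (f i) -> col j -> M i j = t * expansion th f ps i j) ->
  forall ps1 ps2, ps = ps1 ++ ps2 -> exists (M' : 'M[R]_(p, n)) t',
    [/\ normal (run f ps1) M', t' != 0,
      forall i j, ~~ col (run f ps1 i) -> col j ->
        M' i j = t' * expansion th (run f ps1) ps2 i j
    & forall e, exists2 m, m != 0 & forall g,
        cnt col g = (cnt col (run f ps1) + e)%N -> cdet g M = m * cdet g M'].
Proof.
move=> vf nd fM t0 ME ps1; elim: ps1 f ps M t t0 vf nd fM ME.
  move=> f ps M t t0 vf nd fM ME ps2 /= eps; subst ps; exists M, t; split=> // e.
  by exists 1 => [|g _]; rewrite ?oner_neq0 ?mul1r.
move=> u ps1 IH f [//|v ps] M t t0 vf [s0 nd] fM ME ps2 /= [euv eps].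
subst v ps.
have [fu /andP[cu cuf] vf1] := and3P vf.
have [M1 [fM1 M1E M1D]] := pivot fM fu cu t0 (expansion_pivot th vf) ME.
have [|M' [t' [fM' t'0 M'E M'D]]] := IH _ _ M1 _ s0 vf1 nd fM1 _ ps2 erefl.
  move=> i j; rewrite live_row_upd // => /andP[iu fi] cj.
  by rewrite M1E // expansion_schur.
exists M', t'; split=> // e; have [m m0 mE] := M'D e.
(* The exponent of [t] is [cnt col g - cnt col f]. *)
exists (t ^+ (size ps1).+1 * t ^+ e * m).
  by rewrite !mulf_neq0 ?expf_neq0.
move=> g cg; apply: (@mulfI _ (t ^+ cnt col f)); first by rewrite expf_neq0.
rewrite M1D (mE _ cg) cg /= (cnt_run (valid_catl vf1)) cnt_upd //.
by rewrite !exprD !exprS; ring.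
Qed.

End Factorization.

(* A pivot in a live block of size one is allowed to vanish. *)
Definition lone f u :=
  (forall i, ~~ col (f i) -> i = u.1) /\ (forall j, live_col f j -> j = u.2).

Lemma normal_dead_col (R : pzRingType) f (M : 'M[R]_(p, n)) i j :
  normal f M -> ~~ col (f i) -> col j -> ~~ live_col f j -> M i j = 0.
Proof.
move=> fM fi cj; rewrite /live_col cj negbK => /codomP[a ja].
rewrite ja fM; case: eqP => // ia; by rewrite ia -ja cj in fi.
Qed.

(** Elimination along prescribed pivots recovers the parameters from the matrix, provided each pivot
    is nonzero or alone in its live block. *)
Lemma gauss (K : fieldType) f ps (M : 'M[K]_(p, n)) :
    valid f ps -> exhausted (run f ps) -> normal f M ->
    (forall ps1 u ps2, ps = ps1 ++ u :: ps2 ->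
       cdet (run f (rcons ps1 u)) M != 0 \/ lone (run f ps1) u) ->
  exists th : 'I_p -> 'I_n -> K, forall i j, ~~ col (f i) -> col j ->
    M i j = head_scale th ps * expansion th f ps i j.
Proof.
elim: ps f M => [|u ps IH] f M.
  move=> _ ex fM _; exists (fun _ _ => 0) => i j fi cj; rewrite mul0r.
  case: ex => [/(_ i)|/(_ j)]; first by rewrite (negPf fi).
  exact: normal_dead_col.
move=> vuf; have [fu cu vf] := and3P vuf; have cu2 : col u.2 by case/andP: cu.
move=> ex fM good; have [M0|M0] := eqVneq (M u.1 u.2) 0.
  have [|[lr lc]] := good [::] u ps erefl.
    by rewrite /= normal_cdet_upd // M0 eqxx.
  (* The only live entry is the vanishing pivot, so the whole block is zero and scale 0 represents
     it. *)
  exists (fun _ _ => 0) => i j fi cj; rewrite mul0r (lr _ fi).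
  have [/lc->//|] := boolP (live_col f j).
  by apply: normal_dead_col; rewrite // -(lr _ fi).
set t := M u.1 u.2 in M0.
pose E i j := M i j / t.
have ME i j : ~~ col (f i) -> col j -> M i j = t * E i j by rewrite /E mulrC divfK.
have Eu : E u.1 u.2 = 1 by rewrite /E divff.
have [M1 [fM1 M1E M1D]] := pivot fM fu cu2 M0 Eu ME.
have [|th' th'E] := IH _ M1 vf ex fM1.
  move=> ps1 v ps2 eps.
  have [|D0|ln] := good (u :: ps1) v ps2; rewrite ?eps //; last by right.
  left; apply: contraNneq D0 => D0.
  have /eqP := M1D (run (upd f u.1 u.2) (rcons ps1 v)).
  by rewrite D0 mulr0 mulf_eq0 expf_eq0 (negPf M0) andbF.
(* Row and column of the first pivot come from the matrix divided by [t]. At the second pivot a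
   product is added to offset the one subtracted in [next_scale]. *)
pose th i j :=
  if i == u.1 then (if j == u.2 then t else E u.1 j)
  else if j == u.2 then E i u.2
  else if ps is v :: _ then
    if (i, j) == v then th' i j + E v.1 u.2 * E u.1 v.2 else th' i j
  else th' i j.
have same : expansion th (upd f u.1 u.2) ps =2 expansion th' (upd f u.1 u.2) ps.
  apply: eq_expansion => // i j; rewrite live_row_upd // => /andP[iu _].
  rewrite live_col_upd // => /andP[ju _]; rewrite /th (negPf iu) (negPf ju).
  by case: (ps) => // v ps1 /= /negPf ->.
have scale : next_scale th u ps = head_scale th' ps \/ ps = [::].
  case: ps vf {IH ex good th'E same vuf} @th => [|v ps] vf th; first by right.
  left; rewrite /= /th.
  have [fv cv _] := and3P vf; move: fv cv.
  rewrite live_row_upd // live_col_upd // => /andP[/negPf-> _] /andP[/negPf-> _].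
  by rewrite -surjective_pairing !eqxx addrK.
exists th => i j fi cj.
have -> : head_scale th (u :: ps) = t by rewrite /= /th !eqxx.
rewrite ME //; congr (t * _).
have [->|iu] := eqVneq i u.1.
  rewrite expansion_pivot_row //; case: eqP => [->//|/eqP ju].
  case: ifP => [_|/negbT cfj]; first by rewrite /th eqxx (negPf ju).
  by rewrite /E (normal_dead_col fM) ?mul0r.
have /eqP := expansion_schur th i j vuf; rewrite subr_eq => /eqP ->.
rewrite same expansion_pivot_row // expansion_pivot_col //.
rewrite (negPf iu) (negPf fi).
have -> : next_scale th u ps * expansion th' (upd f u.1 u.2) ps i j = M1 i j.
  rewrite th'E ?live_row_upd ?iu //.
  by case: scale => [->//|->]; rewrite /= !mulr0.
rewrite M1E //; have -> : th i u.2 = E i u.2 by rewrite /th (negPf iu) eqxx.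
case: eqP => [->|/eqP ju]; first by rewrite Eu !mulr1 subrr add0r.
case: ifP => [_|/negbT cfj].
  by rewrite /th eqxx (negPf ju) subrK.
have -> : E u.1 j = 0 by rewrite /E (normal_dead_col fM) ?mul0r.
by rewrite mulr0 subr0 addr0.
Qed.

End PivotChains.

(** * The charts of the blow-up *)

Lemma smooth_at_ext (K : fieldType) m (I I' : {mpoly K[m]} -> Prop) z :
  (forall f, I f <-> I' f) -> smooth_at I z -> smooth_at I' z.
Proof.
move=> II' [c [g [gI gen rf]]]; exists c, g; split=> //.
  by move=> i; apply/II'.
by move=> f /II'; apply: gen.
Qed.

Section ChartCoordinates.

Variables (K : numFieldType) (s p n : nat).
Implicit Types (J : chart s p n) (c : factor s p n) (I : plucker_index p n).
Implicit Types (x : 'M[K]_(p, n)).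

Definition coord_index J (i : 'I_(chart_dim J)) :
    factor s p n * plucker_index p n :=
  val (enum_val i : chart_coord J).

(* The junk value for [I] outside the block of [c] is 1. *)
Definition hcoord J c I : {mpoly K[chart_dim J]} :=
  if insub (c, I) is Some u then 'X_(enum_rank (u : chart_coord J)) else 1.

Lemma hcoord_base J c : hcoord J c (val J c) = 1.
Proof. by rewrite /hcoord insubF //= eqxx andbF. Qed.

Lemma coord_indexP J i :
  (coord_index (J := J) i).2 \in block s n (val (coord_index i).1).
Proof. by have /andP[] := valP (enum_val i : chart_coord J). Qed.

Lemma hcoordX J (i : 'I_(chart_dim J)) :
  hcoord J (coord_index i).1 (coord_index i).2 = 'X_i.
Proof.
rewrite /hcoord /coord_index -surjective_pairing valK.
by rewrite enum_valK.
Qed.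

Lemma hcoordP J c I : I \in block s n (val c) -> I = val J c \/
  exists i : 'I_(chart_dim J), coord_index i = (c, I).
Proof.
move=> Ic; have [|IJ] := eqVneq I (val J c); [by left | right].
have cI : ((c, I).2 \in block s n (val (c, I).1)) && ((c, I).2 != val J (c, I).1).
  by rewrite Ic.
exists (enum_rank (exist _ (c, I) cI : chart_coord J)).
by rewrite /coord_index enum_rankK.
Qed.

Lemma hcoord_chart_map J x c I : in_chart J x -> I \in block s n (val c) ->
  (hcoord J c I).@[@chart_map _ _ _ _ J x] = plucker I x / plucker (val J c) x.
Proof.
move=> [_ Jx] /(hcoordP J)[->|[i ic]]; first by rewrite hcoord_base meval1 divff.
have -> : hcoord J c I = 'X_i by rewrite -hcoordX ic.
by rewrite mevalXU /chart_map -/(coord_index i) ic.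
Qed.

Definition image_points J (z : 'I_(chart_dim J) -> K) :=
  exists2 x, in_chart J x & z =1 chart_map x.

Lemma blowup_idealE J (f : {mpoly K[chart_dim J]}) :
  blowup_ideal f <-> forall z, image_points z -> f.@[z] = 0.
Proof.
split=> [If z [x xJ zx]|If x xJ]; first by rewrite (meval_eq _ zx) If.
by apply: If; exists x.
Qed.

Section Change.

Variables J J' : chart s p n.

(** All components of the change of chart are put over this one denominator, the form that [ratmap]
    requires. *)
Definition change_den : {mpoly K[chart_dim J]} := \prod_c hcoord J c (val J' c).

Definition change_num (i : 'I_(chart_dim J')) : {mpoly K[chart_dim J]} :=
  let cI := coord_index i in
  hcoord J cI.1 cI.2 * \prod_(c | c != cI.1) hcoord J c (val J' c).

Lemma change_denP z : (change_den.@[z] != 0) <->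
  forall c, (hcoord J c (val J' c)).@[z] != 0.
Proof.
rewrite rmorph_prod; split=> [/prodf_neq0 H c|H]; first exact: H.
by apply/prodf_neq0 => c _; apply: H.
Qed.

Lemma hcoord_change z c I : change_den.@[z] != 0 -> I \in block s n (val c) ->
  (hcoord J' c I).@[ratmap change_den change_num z] =
  (hcoord J c I).@[z] / (hcoord J c (val J' c)).@[z].
Proof.
move=> qz /(hcoordP J')[->|[i ic]].
  by rewrite hcoord_base meval1 divff //; have /change_denP := qz; apply.
have -> : hcoord J' c I = 'X_i by rewrite -hcoordX ic.
rewrite mevalXU /ratmap.
move: qz; rewrite /change_num ic /= /change_den (bigD1 c) //= !mevalM.
by rewrite mulf_eq0 negb_or => /andP[h0 h1]; field; rewrite h0.
Qed.

Lemma image_points_change z : image_points z -> change_den.@[z] != 0 ->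
  image_points (ratmap change_den change_num z).
Proof.
move=> [x xJ zx] qz.
have JxE c I : I \in block s n (val c) ->
    (hcoord J c I).@[z] = plucker I x / plucker (val J c) x.
  by move=> Ic; rewrite (meval_eq _ zx) hcoord_chart_map.
have J'b c : val J' c \in block s n (val c) by have /forallP := valP J'; apply.
have Jx c := proj2 xJ c.
have J'x : in_chart J' x.
  split=> [|c]; first by case: xJ.
  have /change_denP/(_ c) := qz; rewrite JxE //.
  by apply: contraNneq => ->; rewrite mul0r.
exists x => // i.
transitivity ((hcoord J' (coord_index i).1 (coord_index i).2).@[
    ratmap change_den change_num z]).
  by rewrite hcoordX mevalXU.
rewrite hcoord_change ?coord_indexP // !JxE ?coord_indexP //.
rewrite /chart_map -/(coord_index i); have := proj2 J'x (coord_index i).1.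
by have := Jx (coord_index i).1 => h1 h2; field; rewrite h1 h2.
Qed.

End Change.

Lemma changeK J J' z : (change_den J J').@[z] != 0 ->
  (change_den J' J).@[ratmap (change_den J J') (@change_num J J') z] != 0 /\
  ratmap (change_den J' J) (@change_num J' J)
    (ratmap (change_den J J') (@change_num J J') z) =1 z.
Proof.
move=> qz; have /change_denP h0 := qz.
have Jb c : val J c \in block s n (val c) by have /forallP := valP J; apply.
have q'z : (change_den J' J).@[ratmap (change_den J J') (@change_num J J') z] != 0.
  apply/change_denP => c; rewrite hcoord_change // hcoord_base meval1 mul1r.
  by rewrite invr_eq0.
split=> // i; rewrite -[LHS]mevalXU -hcoordX hcoord_change ?coord_indexP //.
rewrite !hcoord_change ?coord_indexP // hcoord_base meval1 mul1r invrK divfK //.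
by rewrite hcoordX mevalXU.
Qed.

Lemma smooth_at_change J J' z :
    (forall c, (hcoord J c (val J' c)).@[z] != 0) ->
    zero_locus (@blowup_ideal K s p n J) z ->
    (forall z', smooth_at (@blowup_ideal K s p n J') z') ->
  smooth_at (@blowup_ideal K s p n J) z.
Proof.
move=> hz zI sm.
apply: (@smooth_at_ext _ _ (fun f => forall z, image_points z -> f.@[z] = 0)).
  by move=> f; split=> /blowup_idealE.
apply: (@smooth_at_transition _ _ _ (change_den J J') (@change_num J J')
  (change_den J' J) (@change_num J' J) _ _ (@image_points J) (@image_points J')).
- exact: changeK.
- exact: changeK.
- by move=> x Xx qx; apply: image_points_change.
- by move=> x Xx qx; apply: image_points_change.
- exact/change_denP.
- by move=> f /blowup_idealE; apply: zI.
- apply: smooth_at_ext (sm _) => f; exact: blowup_idealE.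
Qed.

End ChartCoordinates.

(** * Adapted charts through a given point *)

Section Combinatorics.

Variables (s p n : nat).
Implicit Types (f g : {ffun 'I_p -> 'I_n}) (I : plucker_index p n).

Definition in_level (c : option 'I_p.+1) g :=
  if c is Some k then cnt (fun j => s <= j)%N g == k else true.

Lemma cnt_comp (col : pred 'I_n) f g (t : 'S_p) :
  (forall a, f a = g (t a)) -> cnt col f = cnt col g.
Proof.
move=> fg; rewrite /cnt -[RHS](card_preimset _ (@perm_inj _ t)).
by apply: eq_card => a; rewrite !inE fg.
Qed.

Lemma cntC (col : pred 'I_n) g : (cnt (predC col) g + cnt col g = p)%N.
Proof.
rewrite -[RHS]card_ord -(cardC [pred a | col (g a)]) addnC /cnt; congr addn.
  by apply: eq_card => a; rewrite !inE.
by apply: eq_card => a; rewrite !inE.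
Qed.

Lemma in_block c I : (I \in block s n c) = in_level c (val I).
Proof. by case: c => [k|]; rewrite !inE. Qed.

Lemma upd_inj f i j : injective f -> j \notin codom f -> injective (upd f i j).
Proof.
move=> f_inj jN a b; rewrite !ffunE.
case: eqP => [->|_]; case: eqP => [->|_] //; last exact: f_inj.
  by move=> jb; case/codomP: jN; exists b.
by move=> ja; case/codomP: jN; exists a.
Qed.

Lemma run_inj (col : pred 'I_n) f ps : injective f -> valid col f ps ->
  injective (run f ps).
Proof.
elim: ps f => //= u ps IH f f_inj /and3P[_ /andP[_ cu] vf].
by apply: IH => //; apply: upd_inj.
Qed.

Lemma cnt_exchange (col : pred 'I_n) f g : injective f -> injective g ->
  (cnt col f < cnt col g)%N -> exists q, live_col col f (g q).
Proof.
move=> f_inj g_inj lt_fg; apply/existsP; apply: contraLR lt_fg => /existsPn nl.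
rewrite -leqNgt /cnt -[X in (X <= _)%N](card_imset _ g_inj).
rewrite -[X in (_ <= X)%N](card_imset _ f_inj).
apply: subset_leq_card; apply/subsetP => _ /imsetP[a aA ->].
move: aA; rewrite inE => ca.
have := nl a; rewrite /live_col ca negbK => /codomP[b gb].
by apply/imsetP; exists b; rewrite ?inE -?gb.
Qed.

Lemma exhausted_max (col : pred 'I_n) f g : injective f -> injective g ->
  exhausted col f -> (cnt col g <= cnt col f)%N.
Proof.
move=> f_inj g_inj [cf|nl].
  have -> : cnt col f = #|'I_p| by apply: eq_card => a; rewrite !inE cf.
  exact: max_card.
by rewrite leqNgt; apply/negP => /cnt_exchange[]// q; apply/negP.
Qed.

Lemma level_codom c f g : (#|block s n c| <= 1)%N ->
  injective f -> injective g -> in_level c f -> in_level c g ->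
  codom f =i codom g.
Proof.
move=> c1 /sort_injective[I [t ft]] /sort_injective[I' [t' gt']] cf cg.
have lev (h : {ffun 'I_p -> 'I_n}) (I0 : plucker_index p n) (t0 : 'S_p) :
    (forall a, h a = val I0 (t0 a)) -> in_level c h -> I0 \in block s n c.
  move=> ht; rewrite in_block /in_level; case: (c) => // k.
  by rewrite (cnt_comp _ ht).
have /card_le1P/(_ I (lev _ _ _ ft cf)) cI := c1.
have := lev _ _ _ gt' cg; rewrite cI => /eqP EI.
move=> j; apply/codomP/codomP => -[a ->].
  by exists (t'^-1%g (t a)); rewrite gt' ft permKV EI.
by exists (t^-1%g (t' a)); rewrite gt' ft permKV EI.
Qed.

End Combinatorics.

(** * Pluecker relations on the closure and the choice of pivots *)

Section FunctionCoordinates.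

Variables (K : numFieldType) (s p n : nat) (J : chart s p n).
Implicit Types (c : factor s p n) (I : plucker_index p n).
Implicit Types (f g h : {ffun 'I_p -> 'I_n}).

(* The sign is that of the sorting permutation; 0 if [g] is not injective. *)
Definition fcoord c g : {mpoly K[chart_dim J]} :=
  if [pick v : plucker_index p n * 'S_p | [forall a, g a == val v.1 (v.2 a)]]
    is Some v then (-1) ^+ v.2 *: hcoord K J c v.1 else 0.

Lemma fcoord_chart_map (x : 'M[K]_(p, n)) c g :
    in_chart J x -> (injective g -> in_level s (val c) g) ->
  (fcoord c g).@[@chart_map K s p n J x] = cdet g x / plucker (val J c) x.
Proof.
move=> xJ cg; rewrite /fcoord; case: pickP => [[I t] /= /forallP gI|noI].
  have gIE a : g a = val I (t a) by apply/eqP.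
  have g_inj : injective g.
    by move=> a b; rewrite !gIE => /(@plucker_index_inj _ _ I)/perm_inj.
  rewrite mevalZ hcoord_chart_map //; last first.
    rewrite in_block /in_level; have := cg g_inj; case: (val c) => // k.
    by rewrite /in_level (cnt_comp _ gIE).
  by rewrite (cdet_perm _ gIE) mulrA.
rewrite meval0.
have [/injectiveP g_inj|/injectivePn[a [b ab gab]]] := boolP (injectiveb g).
  have [I [t gI]] := sort_injective g_inj.
  by have /= /forallP[] := noI (I, t); move=> a; rewrite gI.
by rewrite (cdet_noninj _ ab gab) mul0r.
Qed.

Variable z : 'I_(chart_dim J) -> K.
Hypothesis zI : zero_locus (@blowup_ideal K s p n J) z.

Lemma fcoord_base c : (fcoord c (val (val J c))).@[z] = 1.
Proof.
apply/eqP; rewrite -subr_eq0 -[1](meval1 z) -mevalB; apply/eqP/zI => x xJ.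
rewrite mevalB fcoord_chart_map //; last first.
  by move=> _; rewrite -in_block; have /forallP := valP J; apply.
by rewrite meval1 divff ?subrr //; exact: (proj2 xJ c).
Qed.

Lemma hcoord_fcoord c g I (t : 'S_p) : in_level s (val c) g ->
  (forall a, g a = val I (t a)) ->
  (fcoord c g).@[z] = (-1) ^+ t * (hcoord K J c I).@[z].
Proof.
move=> cg gI; rewrite -mevalZ; apply/eqP; rewrite -subr_eq0 -mevalB.
apply/eqP/zI => x xJ; rewrite mevalB mevalZ fcoord_chart_map //.
rewrite hcoord_chart_map //; last first.
  rewrite in_block /in_level; have := cg; case: (val c) => // k.
  by rewrite /in_level (cnt_comp _ gI).
by rewrite (cdet_perm _ gI) mulrA subrr.
Qed.

(** On the image both factors carry the same minors up to scalars; this proportionality is a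
    polynomial condition, so it persists on the closure. *)
Lemma fcoord_level c1 c2 g1 g2 :
    in_level s (val c1) g1 -> in_level s (val c1) g2 ->
    in_level s (val c2) g1 -> in_level s (val c2) g2 ->
  (fcoord c1 g1).@[z] * (fcoord c2 g2).@[z] =
  (fcoord c1 g2).@[z] * (fcoord c2 g1).@[z].
Proof.
move=> l11 l12 l21 l22; apply/eqP; rewrite -subr_eq0 -!mevalM -mevalB.
apply/eqP/zI => x xJ; rewrite mevalB !mevalM !fcoord_chart_map //.
by rewrite mulrACA [X in _ - X]mulrACA [cdet g2 x * _]mulrC subrr.
Qed.

Lemma fcoord_level_neq0 c1 c2 g :
    in_level s (val c1) g -> in_level s (val c1) (val (val J c2)) ->
    in_level s (val c2) g -> (fcoord c1 g).@[z] != 0 ->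
  (fcoord c2 g).@[z] != 0.
Proof.
move=> l1 l1J l2 g0; apply/eqP => E.
have l2J : in_level s (val c2) (val (val J c2)).
  by rewrite -in_block; have /forallP := valP J; apply.
have := fcoord_level l1 l1J l2 l2J; rewrite E mulr0 (fcoord_base c2) mulr1.
exact/eqP.
Qed.

(** In every term of [cdet_exchange] one minor has the count of [f] and the other that of [g]. The
    relation is thus homogeneous in the coordinates of [c1] and of [c2], and it extends to the
    closure. *)
Lemma fcoord_exchange (col : pred 'I_n) c1 c2 f g q :
    (forall h, injective h -> cnt col h = cnt col f -> in_level s (val c1) h) ->
    (forall h, injective h -> cnt col h = (cnt col f).+1 ->
       in_level s (val c2) h) ->
    cnt col g = (cnt col f).+1 -> col (g q) ->
  (fcoord c1 f).@[z] * (fcoord c2 g).@[z] =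
  \sum_i if col (f i)
    then (fcoord c1 (upd f i (g q))).@[z] * (fcoord c2 (upd g q (f i))).@[z]
    else (fcoord c2 (upd f i (g q))).@[z] * (fcoord c1 (upd g q (f i))).@[z].
Proof.
move=> l1 l2 fg cq; set F := fun i => if col (f i)
  then fcoord c1 (upd f i (g q)) * fcoord c2 (upd g q (f i))
  else fcoord c2 (upd f i (g q)) * fcoord c1 (upd g q (f i)).
have Fsum w : (\sum_i F i).@[w] = \sum_i (F i).@[w] by rewrite raddf_sum.
transitivity ((\sum_i F i).@[z]); last first.
  by rewrite Fsum; apply: eq_bigr => i _; rewrite /F; case: ifP; rewrite /= mevalM.
rewrite -mevalM; apply/eqP; rewrite -subr_eq0 -mevalB; apply/eqP/zI => x xJ.
rewrite mevalB mevalM Fsum !fcoord_chart_map //=; try by move=> h; auto.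
rewrite mulrACA (cdet_exchange _ _ _ q) mulr_suml -sumrB big1 // => i _; rewrite /F.
case: ifP => [cfi|/negbT cfi]; rewrite mevalM !fcoord_chart_map //.
- by rewrite mulrACA subrr.
- by move=> h; apply: l2 => //; rewrite cnt_upd_eq ?cq ?cfi.
- by move=> h; apply: l1 => //; rewrite cnt_upd_eq ?cq ?cfi.
- by ring.
- move=> h; apply: l1 => //; apply: succn_inj; rewrite -fg.
  rewrite -(@cnt_upd _ _ col _ q (g q)) ?ffunE ?eqxx //.
  by congr cnt; apply/ffunP => a; rewrite !ffunE; case: eqP => // ->.
- by move=> h; apply: l2 => //; rewrite cnt_upd.
Qed.

Lemma fcoord_step (col : pred 'I_n) c1 c2 f :
    injective f -> (fcoord c1 f).@[z] != 0 ->
    (forall h, injective h -> cnt col h = cnt col f -> in_level s (val c1) h) ->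
    (forall h, injective h ->
       in_level s (val c2) h = (cnt col h == (cnt col f).+1)) ->
  exists u, [/\ ~~ col (f u.1), live_col col f u.2
    & (fcoord c2 (upd f u.1 u.2)).@[z] != 0].
Proof.
move=> f_inj f0 l1 l2.
(* In the exchange relation for [f] and a [g] as close as possible to [f] with
   [fcoord c2 g] nonzero, the terms with [f i] colored vanish. *)
pose P g := [&& injectiveb g, cnt col g == (cnt col f).+1
              & (fcoord c2 g).@[z] != 0].
pose dist g := #|[set a | g a \notin codom f]|.
have Pb : P (val (val J c2)).
  have b_inj := @plucker_index_inj _ _ (val J c2).
  apply/and3P; split; first exact/injectiveP.
    by rewrite -l2 // -in_block; have /forallP := valP J; apply.
  by rewrite fcoord_base oner_neq0.
case: (arg_minnP dist Pb) => g /and3P[/injectiveP g_inj /eqP cg g0] gmin.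
have [|q /andP[cq qN]] := cnt_exchange (col := col) f_inj g_inj; first by rewrite cg.
have := fcoord_exchange l1 (fun h hi ch => etrans (l2 h hi) (introT eqP ch)) cg cq.
(* A nonzero coordinate with [f i] uncolored gives the pivot: row [i], column [g q]. *)
have [i /andP[cfi gi0] _|nz E] := pickP (fun i => ~~ col (f i) &&
    ((fcoord c2 (upd f i (g q))).@[z] != 0)).
  by exists (i, g q); split; rewrite // /live_col cq.
suff E0 : (fcoord c1 f).@[z] * (fcoord c2 g).@[z] = 0.
  by have /eqP/(_ E0) := mulf_neq0 f0 g0.
rewrite {}E big1 // => i _; case: ifP => cfi; last first.
  by have := nz i; rewrite cfi /= => /negbFE/eqP->; rewrite mul0r.
have [->|g'0] := eqVneq (fcoord c2 (upd g q (f i))).@[z] 0; first by rewrite mulr0.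
have fiN : f i \notin codom g.
  apply: contraNN g'0 => /codomP[a fia].
  have aq : a != q.
    by apply: contraNneq qN => <-; rewrite -fia; apply/codomP; exists i.
  rewrite /fcoord; case: pickP => [[I t] /= /forallP gI|_]; last by rewrite meval0.
  have gIE b : upd g q (f i) b = val I (t b) by apply/eqP.
  suff : a = q by move/eqP; rewrite (negPf aq).
  apply: (@perm_inj _ t); apply: (@plucker_index_inj _ _ I).
  by rewrite -!gIE !ffunE eqxx (negPf aq).
have /gmin : P (upd g q (f i)).
  rewrite /P g'0 andbT cnt_upd_eq ?cq ?cfi // cg eqxx andbT.
  exact/injectiveP/upd_inj.
rewrite leqNgt => /negP[]; apply: proper_card; apply/properP; split.
  apply/subsetP => a; rewrite !inE ffunE; case: eqP => // _.
  by rewrite codom_f.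
by exists q; rewrite !inE ?ffunE ?eqxx // codom_f.
Qed.

(** All exchanges lead to the single set of columns of the next level, hence they all use the same
    row and the same column. *)
Lemma lone_pivot (col : pred 'I_n) (c : option 'I_p.+1) f u :
    injective f -> ~~ col (f u.1) -> live_col col f u.2 ->
    (forall h, injective h -> in_level s c h = (cnt col h == (cnt col f).+1)) ->
    (#|block s n c| <= 1)%N ->
  lone col f u.
Proof.
move=> f_inj fu /andP[cu uN] lc c1.
have same i j : ~~ col (f i) -> live_col col f j ->
    codom (upd f i j) =i codom (upd f u.1 u.2).
  move=> fi /andP[cj jN].
  by apply: level_codom c1 _ _ _ _; rewrite ?lc ?cnt_upd //; exact: upd_inj.
have upd_codom i j a : (a \in codom (upd f i j)) =
    (a == j) || ((a \in codom f) && (a != f i)).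
  apply/codomP/orP => [[b ->]|[/eqP->|/andP[/codomP[b ->] bi]]].
  - rewrite ffunE; case: (eqVneq b i) => [_|bi]; [by left|right].
    by rewrite codom_f (inj_eq f_inj).
  - by exists i; rewrite ffunE eqxx.
  - by exists b; rewrite ffunE; case: (eqVneq b i) bi => [->|//]; rewrite eqxx.
split=> [i fi|j lj].
  have := same i u.2 fi (introT andP (conj cu uN)) (f i).
  rewrite !upd_codom eqxx andbF orbF codom_f /=.
  case: eqP => [fiu|_]; first by rewrite -fiu codom_f in uN.
  by move=> /esym/negbFE/eqP/f_inj.
have := same u.1 j fu lj j; rewrite !upd_codom eqxx /=.
by case/andP: lj => _ /negPf-> /=; rewrite orbF => /esym/eqP.
Qed.

Variables (col : pred 'I_n) (lvl : nat -> option 'I_p.+1).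
Hypothesis lvlP : forall k h, (k <= p)%N -> injective h ->
  in_level s (lvl k) h = (cnt col h == k).

(** The second case is that of a level left out of the product, which provides no coordinate to
    test. *)
Definition reaches f u :=
  (exists2 c, val c = lvl (cnt col f).+1 & (fcoord c (upd f u.1 u.2)).@[z] != 0) \/
  (#|block s n (lvl (cnt col f).+1)| <= 1)%N /\ lone col f u.

(** While the next level is a factor, [fcoord_step] finds a pivot with nonzero coordinate at [z].
    Once it is not, the live block has size one and a single last pivot exhausts it. *)
Lemma chain_exists c f :
    injective f -> (fcoord c f).@[z] != 0 ->
    (forall h, injective h -> cnt col h = cnt col f -> in_level s (val c) h) ->
  exists ps, [/\ valid col f ps, exhausted col (run f ps)
    & forall ps1 u ps2, ps = ps1 ++ u :: ps2 -> reaches (run f ps1) u].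
Proof.
have [m] := ubnP (p - cnt col f); elim: m c f => // m IH c f fm f_inj f0 lf.
have [/existsP[r cr]|/existsPn rows] := boolP [exists r, ~~ col (f r)]; last first.
  exists [::]; split=> // [|[]//]; left=> i; exact/negPn/rows.
have [/existsP[b lb]|/existsPn cols] := boolP [exists b, live_col col f b];
    last first.
  by exists [::]; split=> // [|[]//]; right.
have fp : (cnt col f < p)%N.
  rewrite -[X in (_ < X)%N]card_ord -cardsT; apply: proper_card.
  apply/properP; split; first by apply/subsetP=> a; rewrite inE.
  by exists r; rewrite ?inE.
have lc h : injective h ->
    in_level s (lvl (cnt col f).+1) h = (cnt col h == (cnt col f).+1).
  exact: lvlP.
have [c1|c1] := leqP #|block s n (lvl (cnt col f).+1)| 1.
  have ln : lone col f (r, b) by apply: lone_pivot lc c1.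
  exists [:: (r, b)]; split=> /=.
  - by rewrite cr lb.
  - left=> i; rewrite ffunE; case: eqP => [_|ir]; first by case/andP: lb.
    by apply/negPn/negP => /(proj1 ln).
  - by case=> [|? []] //= u ps2 [<- _]; right.
pose c' : factor s p n := exist _ (lvl (cnt col f).+1) c1.
have [u [fu cu u0]] := @fcoord_step col c c' f f_inj f0 lf lc.
have cfu : cnt col (upd f u.1 u.2) = (cnt col f).+1.
  by rewrite cnt_upd //; case/andP: cu.
have [|||ps [vps ex reach]] := IH c' (upd f u.1 u.2) _ _ u0.
- by rewrite cfu; lia.
- by apply: upd_inj => //; case/andP: cu.
- by move=> h h_inj ch; rewrite /= lc // ch cfu.
exists (u :: ps); split=> //=; first by rewrite fu cu.
case=> [|v ps1] w ps2 /= [<- E]; last exact: reach E.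
by left; exists c'.
Qed.

End FunctionCoordinates.

(** * The parametrization of an adapted chart *)

Section PivotedBlock.

Variables (p n : nat) (col : pred 'I_n).
Variables (R : idomainType) (th : 'I_p -> 'I_n -> R).
Variables (f : {ffun 'I_p -> 'I_n}) (ps : seq ('I_p * 'I_n)) (N : 'M[R]_(p, n)).
Hypotheses (f_inj : injective f) (vf : valid col f ps).
Hypotheses (fN : normal f N) (nd : nondegenerate th ps).
Hypothesis (h0 : ps <> [::] -> head_scale th ps != 0).
Hypothesis NE : forall i j, ~~ col (f i) -> col j ->
  N i j = head_scale th ps * expansion col th f ps i j.

Lemma side_chain ps1 ps2 : ps = ps1 ++ ps2 ->
  exists (M : 'M[R]_(p, n)) t, [/\ normal (run f ps1) M, t != 0,
    forall i j, ~~ col (run f ps1 i) -> col j ->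
        M i j = t * expansion col th (run f ps1) ps2 i j
    & forall e, exists2 m, m != 0 & forall g,
        cnt col g = (cnt col (run f ps1) + e)%N -> cdet g N = m * cdet g M].
Proof.
(* Without pivots [head_scale] is 0 and the block vanishes, so 1 serves as a nonzero scale. *)
pose t := if ps is _ :: _ then head_scale th ps else 1.
have t0 : t != 0 by rewrite /t; case: (ps) h0 => [_|u q ->//]; rewrite ?oner_neq0.
apply: pivot_chain vf nd fN t0 _ ps1 ps2 => i j fi cj.
by rewrite NE // /t; case: (ps) => //=; rewrite !mulr0.
Qed.

(** The leading minor is the common factor itself, since it becomes 1 after elimination. *)
Lemma side_divisible l :
  cdet (run f (take l ps)) N != 0 /\
  forall g, cnt col g = cnt col (run f (take l ps)) ->
    exists a, cdet g N = cdet (run f (take l ps)) N * a.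
Proof.
have [M [t [nM _ _ D]]] := side_chain (esym (cat_take_drop l ps)).
have [m m0 mE] := D 0%N; have Em : cdet (run f (take l ps)) N = m.
  by rewrite mE ?addn0 // normal_cdet // mulr1.
rewrite Em; split=> // g cg; exists (cdet g M).
by rewrite mE // cg addn0.
Qed.

(** At the stage where the parameter is an entry, that entry and the pivot are minors with one more
    colored column, and the parameter is their ratio. *)
Lemma side_coord i j : exhausted col (run f ps) ->
    ~~ col (f i) -> live_col col f j -> off_head ps i j ->
  exists l (g : {ffun 'I_p -> 'I_n}), [/\ (0 < l <= size ps)%N, injective g,
      cnt col g = (cnt col f + l)%N
    & cdet g N = cdet (run f (take l ps)) N * th i j].
Proof.
move=> ex fi cj ij.
have [ps1 [u [ps2 [E fi1 cj1 Eij]]]] := expansion_coord th vf ex fi cj ij.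
have [M [t [nM t0 ME D]]] := side_chain E.
have vf1 : valid col f (ps1 ++ u :: ps2) by rewrite -E.
have [m m0 mE] := D 1%N.
have vu : valid col (run f ps1) (u :: ps2).
  exact: valid_catr vf1.
have [fu lu _] := and3P vu; have /andP[cu _] := lu; have /andP[cj2 jN] := cj1.
have v1 := valid_catl vf1.
exists (size ps1).+1, (upd (run f ps1) i j); split.
- by rewrite E size_cat /= addnS ltnS leq_addr.
- by apply: upd_inj => //; apply: run_inj v1.
- by rewrite cnt_upd // (cnt_run v1) addnS.
have -> : run f (take (size ps1).+1 ps) = upd (run f ps1) u.1 u.2.
  by rewrite E -cat_rcons take_size_cat ?size_rcons // /run foldl_rcons.
rewrite !mE ?cnt_upd ?addn1 // !normal_cdet_upd // !ME // Eij.
by rewrite (expansion_pivot th vu) mulr1 mulrA.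
Qed.

End PivotedBlock.

Lemma nondegenerate_generic (p n : nat) (col : pred 'I_n) (R : idomainType)
    (th : 'I_p -> 'I_n -> R) (f f0 : {ffun 'I_p -> 'I_n}) ps :
    (forall i j i' j', j \notin codom f0 -> j' \notin codom f0 ->
       i' != i -> j' != j -> th i' j' - th i' j * th i j' != 0) ->
    (forall j, live_col col f j -> j \notin codom f0) -> valid col f ps ->
  nondegenerate th ps.
Proof.
move=> gen; elim: ps f => //= u ps IH f lf /and3P[fu cu vf].
have cu2 : col u.2 by case/andP: cu.
split; last first.
  by apply: IH vf => j; rewrite live_col_upd // => /andP[_]; apply: lf.
case: ps vf {IH} => [|v ps] /=; first by rewrite oner_neq0.
case/and3P; rewrite live_row_upd // live_col_upd // => /andP[vu _] /andP[vu2 cv] _.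
by apply: gen; rewrite ?lf.
Qed.

Lemma cnt_max (p n : nat) (col : pred 'I_n) (g : {ffun 'I_p -> 'I_n}) :
  (cnt col g <= p)%N.
Proof. by rewrite -[leqRHS]card_ord /cnt; apply: max_card. Qed.

Definition colB (s n : nat) : pred 'I_n := fun j => (s <= j)%N.
Definition colA (s n : nat) : pred 'I_n := predC (@colB s n).

Lemma cnt_colA (s p n : nat) (g : {ffun 'I_p -> 'I_n}) :
  cnt (@colA s n) g = (p - cnt (@colB s n) g)%N.
Proof. by have := cntC (@colB s n) g; rewrite -/(@colA s n); lia. Qed.

(** * Both off-diagonal blocks together *)

Section Parametrization.

Variables (s p n : nat).
Local Notation colB := (@colB s n).
Local Notation colA := (@colA s n).
Variables (f0 : {ffun 'I_p -> 'I_n}) (psu psd : seq ('I_p * 'I_n)).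

(** The leading minors, which are to be the coordinates set to 1: levels above that of [f0] follow
    [psu], levels below follow [psd]. *)
Definition level_index (c : option 'I_p.+1) : {ffun 'I_p -> 'I_n} :=
  if c is Some k then
    if (cnt colB f0 <= k)%N then run f0 (take (k - cnt colB f0) psu)
    else run f0 (take (cnt colB f0 - k) psd)
  else f0.

Hypotheses (f0_inj : injective f0) (vu : valid colB f0 psu) (vd : valid colA f0 psd).
Hypotheses (exu : exhausted colB (run f0 psu)) (exd : exhausted colA (run f0 psd)).

(* [psu] lists pivots that replace columns before [s] by columns after [s],
   [psd] pivots that go the other way. *)
Definition param (R : comPzRingType) (th : 'I_p -> 'I_n -> R) : 'M[R]_(p, n) :=
  \matrix_(i, j)
    if j \in codom f0 then (j == f0 i)%:R
    else if colB (f0 i) == colB j then th i j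
    else if colB j then head_scale th psu * expansion colB th f0 psu i j
    else head_scale th psd * expansion colA th f0 psd i j.

Lemma param_normal (R : comPzRingType) (th : 'I_p -> 'I_n -> R) :
  normal f0 (param th).
Proof. by move=> i a; rewrite mxE codom_f (inj_eq f0_inj) eq_sym. Qed.

Lemma paramB (R : comPzRingType) (th : 'I_p -> 'I_n -> R) i j :
    ~~ colB (f0 i) -> colB j ->
  param th i j = head_scale th psu * expansion colB th f0 psu i j.
Proof.
move=> fi cj; rewrite mxE cj (negPf fi); case: ifP => // jf.
rewrite expansion_col0 ?mulr0 // /live_col ?jf ?andbF //.
by case: eqP => // jfi; rewrite -jfi cj in fi.
Qed.

Lemma paramA (R : comPzRingType) (th : 'I_p -> 'I_n -> R) i j :
    ~~ colA (f0 i) -> colA j ->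
  param th i j = head_scale th psd * expansion colA th f0 psd i j.
Proof.
move=> fi cj; have /negPf cj' : ~~ colB j := cj; have fi' := negPn fi.
rewrite mxE cj'; have -> : colB (f0 i) by apply/negPn.
case: ifP => // jf.
rewrite expansion_col0 ?mulr0 // /live_col ?jf ?andbF //.
by case: eqP => // jfi; rewrite -jfi cj in fi.
Qed.

Lemma map_param (R S : comPzRingType) (h : {rmorphism R -> S})
    (th : 'I_p -> 'I_n -> R) :
  map_mx h (param th) = param (fun i j => h (th i j)).
Proof.
have head q : h (head_scale th q) = head_scale (fun i j => h (th i j)) q.
  by case: q => [|u q] //=; rewrite rmorph0.
apply/matrixP => i j; rewrite !mxE; case: ifP => _; first by rewrite rmorph_nat.
case: ifP => // _; case: ifP => _; by rewrite rmorphM map_expansion head.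
Qed.

(** Exhausted chains attain the extreme counts, so every nonempty level is met before [take] runs
    out of pivots. *)
Lemma level_indexP c (g : {ffun 'I_p -> 'I_n}) : injective g -> in_level s c g ->
  [/\ injective (level_index c), in_level s c (level_index c)
    & if c is Some k then
        if (cnt colB f0 <= k)%N then (k - cnt colB f0 <= size psu)%N
        else (cnt colB f0 - k <= size psd)%N
      else True].
Proof.
case: c => [k|] //= g_inj /eqP cg; rewrite -/colB in cg *.
have vtake col q l : valid col f0 q -> valid col f0 (take l q).
  by move=> vq; apply: (@valid_catl _ _ _ _ _ (drop l q)); rewrite cat_take_drop.
have := exhausted_max (run_inj f0_inj vu) g_inj exu; rewrite (cnt_run vu) => runu.
have := exhausted_max (run_inj f0_inj vd) g_inj exd; rewrite (cnt_run vd) => rund.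
case: leqP => [le|lt].
  have sz : (k - cnt colB f0 <= size psu)%N by lia.
  split=> //; first exact: run_inj (vtake _ _ _ vu).
  by rewrite (cnt_run (vtake _ _ _ vu)) size_takel //; lia.
have sz : (cnt colB f0 - k <= size psd)%N.
  by move: rund; rewrite !cnt_colA; have := cnt_max colB f0; lia.
split=> //; first exact: run_inj (vtake _ _ _ vd).
have := cnt_run (vtake _ _ (cnt colB f0 - k)%N vd); rewrite size_takel // !cnt_colA.
have := cnt_max colB f0; have := cnt_max colB (run f0 (take (cnt colB f0 - k) psd)).
lia.
Qed.

Section Generic.

Variables (R : idomainType) (th : 'I_p -> 'I_n -> R).
Hypothesis th_gen : forall i j i' j', j \notin codom f0 -> j' \notin codom f0 ->
  i' != i -> j' != j -> th i' j' - th i' j * th i j' != 0.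
Hypothesis th_neq0 : forall i j, j \notin codom f0 -> th i j != 0.

Lemma nondegenerateB : nondegenerate th psu.
Proof. by apply: nondegenerate_generic th_gen _ vu => j /andP[]. Qed.

Lemma nondegenerateA : nondegenerate th psd.
Proof. by apply: nondegenerate_generic th_gen _ vd => j /andP[]. Qed.

Lemma head_scaleB : psu <> [::] -> head_scale th psu != 0.
Proof.
by case: (psu) vu => //= u q /and3P[_ /andP[_ cu] _] _; apply: th_neq0.
Qed.

Lemma head_scaleA : psd <> [::] -> head_scale th psd != 0.
Proof.
by case: (psd) vd => //= u q /and3P[_ /andP[_ cu] _] _; apply: th_neq0.
Qed.

Lemma param_divisible c (g0 : {ffun 'I_p -> 'I_n}) :
    injective g0 -> in_level s c g0 ->
  cdet (level_index c) (param th) != 0 /\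
  forall g : {ffun 'I_p -> 'I_n}, in_level s c g ->
    exists a, cdet g (param th) = cdet (level_index c) (param th) * a.
Proof.
move=> g0_inj lg0; have [_] := level_indexP g0_inj lg0.
case: c lg0 => [k|] _ /=; last first.
  rewrite normal_cdet ?oner_neq0 => [_ _|]; last exact: param_normal.
  by split=> // g _; exists (cdet g (param th)); rewrite mul1r.
move=> /eqP lk _.
case: leqP lk => [le|lt] lk.
  have [D0 D] := side_divisible vu (param_normal th) nondegenerateB head_scaleB
    (paramB th) (k - cnt colB f0)%N.
  split=> // g /eqP cg; apply: D; rewrite lk; exact: cg.
have [D0 D] := side_divisible vd (param_normal th) nondegenerateA head_scaleA
  (paramA th) (cnt colB f0 - k)%N.
by split=> // g /eqP cg; apply: D; rewrite !cnt_colA lk -cg.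
Qed.

(** Entries of the diagonal blocks and the first pivots are entries of the matrix, hence ratios at
    the level [None]; the other parameters come from [side_coord]. *)
Lemma param_coord i j : j \notin codom f0 ->
  exists c (g : {ffun 'I_p -> 'I_n}), [/\ injective g, in_level s c g
    & cdet g (param th) = cdet (level_index c) (param th) * th i j].
Proof.
move=> jN; have f0N := param_normal th.
have base : param th i j = th i j -> exists c (g : {ffun 'I_p -> 'I_n}),
    [/\ injective g, in_level s c g
    & cdet g (param th) = cdet (level_index c) (param th) * th i j].
  move=> Eij; exists None, (upd f0 i j); split=> //; first exact: upd_inj.
  by rewrite normal_cdet_upd // normal_cdet // mul1r.
have [same|diff] := boolP (colB (f0 i) == colB j).
  by apply: base; rewrite mxE (negPf jN) same.
have [cj|cj] := boolP (colB j).
  have fi : ~~ colB (f0 i) by move: diff; rewrite cj; case: (colB _).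
  have lj : live_col colB f0 j by rewrite /live_col cj.
  have [off|] := boolP (off_head psu i j); last first.
    case: (psu) vu (paramB th fi cj) => // u q vuq Eij /negPn/eqP iju; apply: base.
    have [iu ju] : i = u.1 /\ j = u.2 by rewrite -[u]iju.
    by rewrite Eij iu ju (expansion_pivot th vuq) mulr1.
  have [l [g [/andP[l0 lp] g_inj cg Eg]]] := side_coord f0_inj vu f0N nondegenerateB
    head_scaleB (paramB th) exu fi lj off.
  have kp : (cnt colB f0 + l < p.+1)%N by rewrite -cg ltnS cnt_max.
  exists (Some (Ordinal kp)), g; split=> //; first exact/eqP.
  by rewrite /= leq_addr addKn.
have fi : ~~ colA (f0 i).
  by move: diff; rewrite (negPf cj) /= /colA /= negbK; case: (colB _).
have lj : live_col colA f0 j by apply/andP; split.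
have [off|] := boolP (off_head psd i j); last first.
  case: (psd) vd (paramA th fi cj) => // u q vuq Eij /negPn/eqP iju; apply: base.
  have [iu ju] : i = u.1 /\ j = u.2 by rewrite -iju.
  by rewrite Eij iu ju (expansion_pivot th vuq) mulr1.
have [l [g [/andP[l0 lp] g_inj cg Eg]]] := side_coord f0_inj vd f0N nondegenerateA
  head_scaleA (paramA th) exd fi lj off.
have kp : (cnt colB f0 - l < p.+1)%N by have := cnt_max colB f0; lia.
have := cnt_max colB g; have := cnt_max colB f0.
move: cg; rewrite !cnt_colA => cg p0 pg.
exists (Some (Ordinal kp)), g; split=> //.
  by apply/eqP; rewrite -/colB /=; lia.
rewrite /= leqNgt; have -> : (cnt colB f0 - l < cnt colB f0)%N by lia.
by have -> : (cnt colB f0 - (cnt colB f0 - l) = l)%N by lia.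
Qed.

End Generic.

End Parametrization.

(** * Smoothness in an adapted chart *)

Section AdaptedChart.

Variables (K : numFieldType) (s p n : nat) (J : chart s p n).
Variables (f0 : {ffun 'I_p -> 'I_n}) (psu psd : seq ('I_p * 'I_n)).
Implicit Types (c : factor s p n).
Local Notation colB := (@colB s n).
Local Notation colA := (@colA s n).
Local Notation level_index := (level_index s f0 psu psd).
Local Notation param := (param s f0 psu psd).
Hypotheses (f0_inj : injective f0) (vu : valid colB f0 psu) (vd : valid colA f0 psd).
Hypotheses (exu : exhausted colB (run f0 psu)) (exd : exhausted colA (run f0 psd)).
Hypothesis J_index : forall c, exists t : 'S_p,
  forall a, level_index (val c) a = val (val J c) (t a).
Hypothesis J_none : exists c : factor s p n, val c = None.
Hypothesis okB : forall ps1 u ps2, psu = ps1 ++ u :: ps2 ->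
  (exists c : factor s p n, level_index (val c) = run f0 (rcons ps1 u)) \/
  lone colB (run f0 ps1) u.
Hypothesis okA : forall ps1 u ps2, psd = ps1 ++ u :: ps2 ->
  (exists c : factor s p n, level_index (val c) = run f0 (rcons ps1 u)) \/
  lone colA (run f0 ps1) u.

(** One variable for each entry outside the identity columns: p(n - p) in all, the dimension of the
    Grassmannian. *)
Definition slot : Type := {ij : 'I_p * 'I_n | ij.2 \notin codom f0}.
HB.instance Definition _ := Finite.on slot.
Local Notation d := #|{: slot}|.

Definition slot_var i j : {mpoly K[d]} :=
  if insub (i, j) is Some u then 'X_(enum_rank (u : slot)) else 1.

Definition slot_val (v : 'I_p -> 'I_n -> K) (k : 'I_d) : K :=
  let ij := val (enum_val k : slot) in v ij.1 ij.2.

Lemma slot_var_eval v i j : j \notin codom f0 ->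
  (slot_var i j).@[slot_val v] = v i j.
Proof.
move=> jN; rewrite /slot_var; case: insubP => [u _ uE|]; last by rewrite jN.
by rewrite mevalXU /slot_val enum_rankK uE.
Qed.

Lemma slot_varX (k : 'I_d) :
  slot_var (val (enum_val k : slot)).1 (val (enum_val k : slot)).2 = 'X_k.
Proof. by rewrite /slot_var -surjective_pairing valK enum_valK. Qed.

Lemma slot_var_neq0 i j : j \notin codom f0 -> slot_var i j != 0.
Proof.
move=> jN; apply/eqP => /(congr1 (meval (slot_val (fun _ _ => 1)))).
by rewrite slot_var_eval // meval0 => /eqP; rewrite oner_eq0.
Qed.

Lemma slot_var_generic i j i' j' : j \notin codom f0 -> j' \notin codom f0 ->
  i' != i -> j' != j ->
  slot_var i' j' - slot_var i' j * slot_var i j' != 0.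
Proof.
move=> jN jN' _ /negPf jj; apply/eqP.
move/(congr1 (meval (slot_val (fun k l => ((k == i') && (l == j'))%:R)))).
rewrite mevalB mevalM !slot_var_eval // !eqxx eq_sym jj andbF mul0r subr0 meval0.
by move/eqP; rewrite oner_eq0.
Qed.

Local Notation N := (param slot_var).

Lemma J_block c : val J c \in block s n (val c).
Proof. by have /forallP := valP J; apply. Qed.

Lemma cdet_J (R : comPzRingType) (x : 'M[R]_(p, n)) c : exists b : bool,
  cdet (level_index (val c)) x = (-1) ^+ b * cdet (val (val J c)) x.
Proof. by have [t tE] := J_index c; exists (odd_perm t); apply: cdet_perm. Qed.

Lemma J_divisible c : cdet (val (val J c)) N != 0 /\
  forall g : {ffun 'I_p -> 'I_n}, in_level s (val c) g ->
    exists a, cdet g N = cdet (val (val J c)) N * a.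
Proof.
have lJ : in_level s (val c) (val (val J c)) by rewrite -in_block J_block.
have [D0 D] := param_divisible f0_inj vu vd exu exd slot_var_generic slot_var_neq0
  (@plucker_index_inj _ _ (val J c)) lJ.
have [b bE] := cdet_J N c; rewrite bE in D0 D; split.
  by move: D0; rewrite mulf_eq0 negb_or => /andP[].
move=> g /D[a ->]; exists ((-1) ^+ b * a); by rewrite mulrCA mulrA.
Qed.

Lemma J_coord (k : 'I_d) : exists (i : 'I_(chart_dim J)) (b : bool),
  cdet (val (coord_index i).2) N =
  cdet (val (val J (coord_index i).1)) N * ((-1) ^+ b *: 'X_k).
Proof.
have kN := valP (enum_val k : slot).
have [c0 [g [g_inj lg Eg]]] := param_coord f0_inj vu vd exu exd slot_var_generic
  slot_var_neq0 (val (enum_val k : slot)).1 kN.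
rewrite slot_varX in Eg.
have [D0 _] := param_divisible f0_inj vu vd exu exd slot_var_generic
  slot_var_neq0 g_inj lg.
have [h_inj lh _] := level_indexP f0_inj vu vd exu exd g_inj lg.
(* A variable up to sign is not 1, so the index with this ratio differs from the base index; its
   level then has two indices and is a factor of the product. *)
have X1 (b : bool) : (-1) ^+ b *: 'X_k != 1 :> {mpoly K[d]}.
  apply/eqP => /(congr1 (meval (fun=> 0))); rewrite mevalZ mevalXU mulr0 meval1.
  by move/esym/eqP; rewrite oner_eq0.
have [I [t gI]] := sort_injective g_inj.
have [I' [t' hI']] := sort_injective h_inj.
have in_b (f : {ffun 'I_p -> 'I_n}) (I0 : plucker_index p n) (t0 : 'S_p) :
    (forall a, f a = val I0 (t0 a)) -> in_level s c0 f -> I0 \in block s n c0.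
  move=> fI; rewrite in_block /in_level; case: (c0) => // l.
  by rewrite (cnt_comp _ fI).
have Ib := in_b _ _ _ gI lg; have Ib' := in_b _ _ _ hI' lh.
have signs (I1 : plucker_index p n) (t1 : 'S_p) :
    (forall a, level_index c0 a = val I1 (t1 a)) ->
    I != I1 /\ cdet (val I) N = cdet (val I1) N * ((-1) ^+ (t (+) t1) *: 'X_k).
  move=> hI1; move: Eg D0; rewrite (cdet_perm _ gI) (cdet_perm _ hI1).
  move=> /(congr1 (fun y => (-1) ^+ t * y)); rewrite mulrA -signr_addb addbb mul1r.
  move=> EI D0.
  have EI' : cdet (val I) N = cdet (val I1) N * ((-1) ^+ (t (+) t1) *: 'X_k).
    by rewrite EI scaler_sign; case: (odd_perm t) (odd_perm t1) => [] [] /=; ring.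
  split=> //; apply: contraNneq (X1 (t (+) t1)) => II.
  apply/eqP; move: D0; rewrite mulf_eq0 negb_or => /andP[_ D0].
  by apply: (mulfI D0); rewrite mulr1 -EI' II.
have [II' _] := signs _ _ hI'.
have c0f : (1 < #|block s n c0|)%N.
  by apply/card_gt1P; exists I, I'; rewrite Ib Ib'.
pose c : factor s p n := exist _ c0 c0f.
have [tc tcE] := J_index c.
have [IJ E] := signs _ _ tcE.
have [IJ'|[i iE]] := hcoordP J (c := c) Ib; first by rewrite IJ' eqxx in IJ.
by exists i, (t (+) tc); rewrite iE.
Qed.

Lemma side_param_eq (col : pred 'I_n) ps (th th' : 'I_p -> 'I_n -> K) i j :
    valid col f0 ps ->
    (forall i j, ~~ col (f0 i) -> live_col col f0 j -> th i j = th' i j) ->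
  head_scale th ps * expansion col th f0 ps i j =
  head_scale th' ps * expansion col th' f0 ps i j.
Proof.
move=> vps E.
rewrite (eq_expansion (th' := th') vps) => [|k l fk cl _]; last exact: E.
by case: ps vps => //= u q /and3P[fu cu _]; rewrite E.
Qed.

Lemma param_surj (x : 'M[K]_(p, n)) : in_chart J x ->
  exists v, map_mx (meval (slot_val v)) N = invmx (colsub f0 x) *m x.
Proof.
move=> [_ xJ].
have level0 c : cdet (level_index (val c)) x != 0.
  by have [b ->] := cdet_J x c; rewrite mulf_neq0 ?signr_eq0 //; apply: xJ.
have A0 : cdet f0 x != 0 by have [c cE] := J_none; have := level0 c; rewrite cE.
have Au : colsub f0 x \in unitmx by rewrite unitmxE unitfE.
set x1 := invmx _ *m x.
have x1n : normal f0 x1.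
  move=> i a; have := mulVmx Au; rewrite mulmx_colsub -/x1.
  by move=> /matrixP/(_ i a); rewrite !mxE.
have x10 g : cdet g x != 0 -> cdet g x1 != 0.
  by move=> gx; rewrite cdet_mull mulf_neq0 // det_inv invr_eq0.
have [|thu thuE] := gauss vu exu x1n.
  move=> ps1 u ps2 /okB[[c cE]|]; [left | by right].
  by apply: x10; rewrite -cE.
have [|thd thdE] := gauss vd exd x1n.
  move=> ps1 u ps2 /okA[[c cE]|]; [left | by right].
  by apply: x10; rewrite -cE.
(* The diagonal blocks and the two off-diagonal ones use disjoint sets of parameters, so the three
   choices can be combined. *)
pose v i j := if colB (f0 i) == colB j then x1 i j
              else if colB j then thu i j else thd i j.
exists v; transitivity (param (fun i j => (slot_var i j).@[slot_val v])).
  by rewrite map_param.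
apply/matrixP => i j; rewrite mxE.
case: ifP => [/codomP[a ->]|/negbT jN].
  by rewrite x1n (inj_eq f0_inj) eq_sym.
case: ifP => [same|diff]; first by rewrite slot_var_eval // /v same.
case: ifP => cj.
  have fi : ~~ colB (f0 i) by move: diff; rewrite cj; case: (colB _).
  rewrite thuE //; apply: side_param_eq => // k l fk /andP[cl lN].
  by rewrite slot_var_eval // /v (negPf fk) cl.
have fi : colB (f0 i) by move: diff; rewrite cj; case: (colB _).
rewrite (thdE i j (introT negPn fi) (negbT cj)).
apply: side_param_eq => // k l fk /andP[cl lN].
have fk' : colB (f0 k) by apply/negPn.
by rewrite slot_var_eval // /v fk' (negPf cl).
Qed.

Lemma adapted_chart_smooth z : smooth_at (@blowup_ideal K s p n J) z.
Proof.
have /fin_all_exists[R RE] (i : 'I_(chart_dim J)) : exists a,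
    cdet (val (coord_index i).2) N = cdet (val (val J (coord_index i).1)) N * a.
  by apply: (proj2 (J_divisible _)); rewrite -in_block coord_indexP.
have /fin_all_exists[e eE] (k : 'I_d) : exists ib : 'I_(chart_dim J) * bool,
    cdet (val (coord_index ib.1).2) N =
    cdet (val (val J (coord_index ib.1).1)) N * ((-1) ^+ ib.2 *: 'X_k).
  by have [i [b E]] := J_coord k; exists (i, b).
have R_chart (x : 'M[K]_(p, n)) v l : l != 0 ->
    (forall g, (cdet g N).@[slot_val v] = l * cdet g x) ->
    in_chart J x -> (fun i => (R i).@[slot_val v]) =1 chart_map x.
  move=> l0 lE [_ xJ] i; have /(congr1 (meval (slot_val v))) := RE i.
  rewrite mevalM !lE -mulrA => /(mulfI l0); rewrite /chart_map -/(coord_index i).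
  by rewrite /plucker -/(cdet _ _) => ->; rewrite mulrAC divff ?mul1r //; apply: xJ.
apply: (@graph_smooth K _ _ _ (fun k => (e k).1) (fun k => (-1) ^+ (e k).2)
  [tuple R i | i < chart_dim J]).
- by move=> k; rewrite signr_eq0.
- move=> k; rewrite tnth_mktuple; have [D0 _] := J_divisible (coord_index (e k).1).1.
  by apply: (mulfI D0); rewrite -RE eE.
have compE f w :
    (f \mPo [tuple R i | i < chart_dim J]).@[w] = f.@[fun i => (R i).@[w]].
  by rewrite comp_mpoly_meval; apply: meval_eq => i; rewrite tnth_mktuple.
move=> f; split=> [If|f0R x xJ]; last first.
  have [v vE] := param_surj xJ.
  have A0 : cdet f0 x != 0.
    have [c cE] := J_none; have := proj2 xJ c; have [b] := cdet_J x c.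
    by rewrite cE /= => ->; rewrite mulf_eq0 signr_eq0.
  rewrite -(meval_eq f (R_chart x v (cdet f0 x)^-1 _ _ xJ)) ?invr_eq0 //.
    by rewrite -compE f0R meval0.
  by move=> g; rewrite -cdet_map vE cdet_mull det_inv.
(* Where [D] is nonzero the parameters define a matrix in the chart, on whose image [f] vanishes. So
   [D] times the pullback of [f] vanishes everywhere, and [D] cancels. *)
pose D := \prod_c cdet (val (val J c)) N.
have D0 : D != 0 by apply/prodf_neq0 => c _; have [] := J_divisible c.
apply: (mulfI D0); rewrite mulr0; apply: mpoly_eq0_meval => w.
rewrite mevalM; have [->|Dw] := eqVneq D.@[w] 0; first by rewrite mul0r.
pose v i j := (slot_var i j).@[w].
have vw : slot_val v =1 w by move=> k; rewrite /slot_val /v slot_varX mevalXU.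
pose x := map_mx (meval (slot_val v)) N.
have xJ : in_chart J x.
  split=> [|c]; last first.
    rewrite /plucker -/(cdet _ _) cdet_map.
    move: Dw; rewrite (meval_eq _ (fsym vw)) rmorph_prod /= => /prodf_neq0; exact.
  apply/row_freeP; exists (\matrix_(j, a) (j == f0 a)%:R).
  have xn : normal f0 x.
    by rewrite /x map_param; apply: param_normal.
  apply/matrixP => i a; rewrite [LHS]mxE (bigD1 (f0 a)) //= big1 => [|j /negPf ja].
    by rewrite addr0 mxE eqxx mulr1 xn mxE.
  by rewrite mxE ja mulr0.
rewrite compE -(meval_eq _ (fun i => meval_eq (R i) vw)).
rewrite (meval_eq f (R_chart x v 1 (oner_neq0 _) _ xJ)) ?If ?mulr0 //.
by move=> g; rewrite cdet_map mul1r.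
Qed.

End AdaptedChart.

(** * The canonical blow-up *)

Lemma reaches_take (K : numFieldType) (s p n : nat) (J : chart s p n)
    (z : 'I_(chart_dim J) -> K) (col : pred 'I_n) lvl f ps l (c : factor s p n) :
    valid col f ps ->
    (forall ps1 u ps2, ps = ps1 ++ u :: ps2 -> reaches z col lvl (run f ps1) u) ->
    (l < size ps)%N -> val c = lvl (cnt col f + l).+1 ->
  (fcoord K J c (run f (take l.+1 ps))).@[z] != 0.
Proof.
move=> vf reach lps cE; have [u0 _] : exists u0, u0 \in ps.
  by case: (ps) lps => // u q _; exists u; rewrite mem_head.
have E : ps = take l ps ++ nth u0 ps l :: drop l.+1 ps.
  by rewrite -drop_nth // cat_take_drop.
have vl : valid col f (take l ps) by move: vf; rewrite {1}E => /valid_catl.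
have Erun : run f (take l.+1 ps) =
    upd (run f (take l ps)) (nth u0 ps l).1 (nth u0 ps l).2.
  by rewrite (take_nth u0 lps) /run foldl_rcons.
have := reach _ _ _ E.
rewrite /reaches (cnt_run vl) size_takel ?(ltnW lps) // -cE Erun.
case=> [[c' c'E c'z]|[c1 _]]; first by rewrite -(val_inj c'E).
by have := valP c; rewrite ltnNge c1.
Qed.

Lemma block_none_gt1 s p n : (0 < p)%N -> (p < n)%N ->
  (1 < #|block s (p := p) n None|)%N.
Proof.
move=> p0 pn; rewrite ltnNge; apply/negP => c1.
pose f : {ffun 'I_p -> 'I_n} := [ffun i => widen_ord (ltnW pn) i].
pose j : 'I_n := Ordinal pn; pose i : 'I_p := Ordinal p0.
have f_inj : injective f by move=> a b; rewrite !ffunE => /(congr1 val) /= /val_inj.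
have jN : j \notin codom f.
  apply/negP => /codomP[a /(congr1 val)]; rewrite ffunE /= => pa.
  by have := ltn_ord a; rewrite -pa ltnn.
have := level_codom c1 f_inj (upd_inj (i := i) f_inj jN) isT isT j.
rewrite (negPf jN) => /esym/negP[]; apply/codomP; exists i.
by rewrite ffunE eqxx.
Qed.

Lemma canonical_blowup_smooth (K : numFieldType) s p n :
  (0 < p)%N -> (p < n)%N -> blowup_smooth K s p n.
Proof.
move=> p0 pn J z zI.
pose cN : factor s p n := exist _ None (block_none_gt1 s p0 pn).
(* The index already set to 1 in the full Pluecker factor of [J], hence nonzero at [z]. *)
pose f0 : {ffun 'I_p -> 'I_n} := val (val J cN).
have f0_inj : injective f0 := @plucker_index_inj _ _ (val J cN).
have f0z : (fcoord K J cN f0).@[z] != 0 by rewrite fcoord_base // oner_neq0.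
pose lvlB k : option 'I_p.+1 := Some (inord k).
pose lvlA k : option 'I_p.+1 := Some (inord (p - k)).
have lvlBP k (h : {ffun 'I_p -> 'I_n}) : (k <= p)%N -> injective h ->
    in_level s (lvlB k) h = (cnt (@colB s n) h == k).
  by move=> kp _; rewrite /= inordK.
have lvlAP k (h : {ffun 'I_p -> 'I_n}) : (k <= p)%N -> injective h ->
    in_level s (lvlA k) h = (cnt (@colA s n) h == k).
  move=> kp _; rewrite /= inordK ?ltnS ?leq_subr // cnt_colA -/(@colB s n).
  by have := cnt_max (@colB s n) h; lia.
have [psu [vu exu reachu]] := chain_exists zI lvlBP f0_inj f0z (fun _ _ _ => isT).
have [psd [vd exd reachd]] := chain_exists zI lvlAP f0_inj f0z (fun _ _ _ => isT).
pose fc := level_index s f0 psu psd.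
have Jb c : in_level s (val c) (val (val J c)).
  by rewrite -in_block; have /forallP := valP J; apply.
have fcP c := level_indexP f0_inj vu vd exu exd
  (@plucker_index_inj _ _ (val J c)) (Jb c).
(* The coordinates to be set to 1 in the new chart do not vanish at [z]: at the level of [f0] by
   comparison with the full factor, elsewhere by the choice of pivots. *)
have fcz c : (fcoord K J c (fc (val c))).@[z] != 0.
  have [_ _ sz] := fcP c; rewrite /fc /level_index.
  case cE: (val c) sz => [k|] sz; last first.
    by have -> : c = cN by apply: val_inj.
  have p0B := cnt_max (@colB s n) f0; have kp := ltn_ord k.
  case: leqP sz => [le|lt] sz.
    case: (posnP (k - cnt (@colB s n) f0)%N) => [k0|].
      have Ek : cnt (@colB s n) f0 == k by lia.
      rewrite k0 take0 /run /=.
      have lc0 : in_level s (val c) f0 by rewrite cE.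
      exact: (fcoord_level_neq0 zI (c1 := cN) isT isT lc0 f0z).
    case El: (k - cnt (@colB s n) f0)%N => [|l]; first by [].
    move=> _; rewrite El in sz.
    apply: (reaches_take vu reachu sz); rewrite cE /lvlB; congr Some.
    by apply: val_inj; rewrite /= inordK; lia.
  case El: (cnt (@colB s n) f0 - k)%N => [|l]; first by lia.
  rewrite El in sz; apply: (reaches_take vd reachd sz); rewrite cE /lvlA; congr Some.
  by apply: val_inj; rewrite /= inordK cnt_colA -/(@colB s n); lia.
have /fin_all_exists[J0 J0E] (c : factor s p n) :
    exists I : plucker_index p n, exists t : 'S_p,
      forall a, fc (val c) a = val I (t a).
  by apply: sort_injective; have [] := fcP c.
have J'b : [forall c, [ffun c => J0 c] c \in block s n (val c)].
  apply/forallP => c; rewrite ffunE in_block; have [t tE] := J0E c.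
  have [_ + _] := fcP c; rewrite /in_level -/fc.
  by case: (val c) tE => // k tE; rewrite (cnt_comp _ tE).
pose J' : chart s p n :=
  exist (fun I : {ffun factor s p n -> plucker_index p n} =>
           [forall c, I c \in block s n (val c)]) [ffun c => J0 c] J'b.
have J'E c : val J' c = J0 c by rewrite /= ffunE.
apply: (smooth_at_change (J' := J')) => // [c|z'].
  rewrite J'E; have [t tE] := J0E c; have [_ lc _] := fcP c.
  have := fcz c; rewrite (hcoord_fcoord zI lc tE).
  by rewrite mulf_eq0 negb_or => /andP[].
apply: (adapted_chart_smooth f0_inj vu vd exu exd).
- by move=> c; rewrite J'E; apply: J0E.
- by exists cN.
- move=> ps1 u ps2 E.
  have [[c cE _]|[_ ln]] := reachu _ _ _ E; [left|by right].
  exists c; rewrite cE /lvlB /=.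
  have v1 : valid (@colB s n) f0 (ps1 ++ u :: ps2) by rewrite -E.
  have le1 : (cnt (@colB s n) f0 + (size ps1).+1 <= p)%N.
    have := cnt_run v1; rewrite size_cat /=.
    by have := cnt_max (@colB s n) (run f0 (ps1 ++ u :: ps2)); lia.
  rewrite (cnt_run (valid_catl v1)) inordK; last by lia.
  rewrite -addnS leq_addr addKn E -cat_rcons take_size_cat //.
  by rewrite size_rcons.
move=> ps1 u ps2 E.
have [[c cE _]|[_ ln]] := reachd _ _ _ E; [left|by right].
exists c; rewrite cE /lvlA /=.
have v1 : valid (@colA s n) f0 (ps1 ++ u :: ps2) by rewrite -E.
have p0B := cnt_max (@colB s n) f0.
have le1 : (cnt (@colA s n) f0 + (size ps1).+1 <= p)%N.
  have := cnt_run v1; rewrite size_cat /=.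
  by have := cnt_max (@colA s n) (run f0 (ps1 ++ u :: ps2)); lia.
rewrite (cnt_run (valid_catl v1)) inordK; last by lia.
move: le1; rewrite cnt_colA -/(@colB s n) => le1.
rewrite leqNgt; have -> /= : (p - (p - cnt (@colB s n) f0 + size ps1).+1
  < cnt (@colB s n) f0)%N by lia.
have -> : (cnt (@colB s n) f0 - (p - (p - cnt (@colB s n) f0 + size ps1).+1) =
  size (rcons ps1 u))%N by rewrite size_rcons; lia.
by rewrite E -cat_rcons take_size_cat.
Qed.

Theorem proposition1p3 (R : realType) (p s n : nat)
  (hp : (0 < p)%N) (hpn : (p < n)%N) (hs : (0 < s)%N) (hsn : (s < n)%N) :
  blowup_smooth (R[i])%C s p n.
Proof. exact: canonical_blowup_smooth. Qed.
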